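(* Let $X\hookrightarrow L^2(D)$ be a separable Banach space and $\mu$ a Borel probability measure on $X$ with $\int_X\|u\|_X^2\,d\mu(u)<\infty$. Suppose $\mathcal{G}$ defines a Lipschitz mapping $\mathcal{G}:X\to H^s(\mathbb{T}^n)$ for some $s>0$, with $$\int_X\|\mathcal{G}(u)\|_{H^s}^2\,d\mu(u)\le M<\infty .$$ Then there exists a constant $C=C(n,s,M)>0$ such that for any $p\in\mathbb{N}$ there exists a trunk net $\tau=(\tau_1,\dots,\tau_p):\mathbb{R}^n\to\mathbb{R}^p$ (with bias term $\tau_0\equiv0$) with $$\mathrm{size}(\tau)\le Cp(1+\log(p)^2),\qquad \mathrm{depth}(\tau)\le C(1+\log(p)^2),$$ and such that the associated reconstruction $\mathcal{R}:\mathbb{R}^p\to L^2(\mathbb{T}^n)$, $\mathcal{R}(\alpha)=\sum_{k=1}^p\alpha_k\tau_k$, satisfies $$\widehat{\mathscr{E}}_{\mathcal{R}}\le C\,p^{-s/n}.$$ Furthermore, $\mathcal{R}$ and the associated optimal projection $\mathcal{P}$ satisfy $\mathrm{Lip}(\mathcal{R}),\mathrm{Lip}(\mathcal{P})\le2$.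
   Context: $D\subset\mathbb{R}^d$ is a compact domain; $\mathbb{T}^n$ is the periodic torus, identified with $[0,2\pi]^n$; $H^s$ is the $L^2$-based Sobolev space. Trunk net: a ReLU neural network $C_K\circ\sigma\circ\cdots\circ\sigma\circ C_1$ ($C_k$ affine, $\sigma(z)=\max(z,0)$ componentwise); size = number of nonzero weights and biases, depth = $K-1$ = number of hidden layers. Optimal projection associated with $\mathcal{R}$ (with $\tau_0\equiv 0$ and $\tau_1,\dots,\tau_p$ linearly independent in $L^2$): $\mathcal{P}:L^2(\mathbb{T}^n)\to\mathbb{R}^p$, $\mathcal{P}(v)=(\langle v,\tau_1^*\rangle,\dots,\langle v,\tau_p^*\rangle)$, where $\tau_k^*\in\mathrm{span}(\tau_1,\dots,\tau_p)$ is the dual basis, $\langle\tau_\ell,\tau_k^*\rangle=\delta_{\ell k}$. Reconstruction error: $\widehat{\mathscr{E}}_{\mathcal{R}}=\left(\int_{L^2}\|\mathcal{R}\circ\mathcal{P}(v)-v\|_{L^2}^2\,d(\mathcal{G}_\#\mu)(v)\right)^{1/2}$, with $\mathcal{G}_\#\mu$ the push-forward measure. Lipschitz constants are with respect to the $\ell^2$-norm on $\mathbb{R}^p$ and the $L^2$-norm on $L^2(\mathbb{T}^n)$. *)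

(* Defs.v *)
From HB Require Import structures.
From mathcomp Require Import all_boot all_order all_algebra.
From mathcomp Require Import all_classical all_reals all_analysis.
From mathcomp Require Import measurable_realfun ess_sup_inf complex.
Set Implicit Arguments.
Unset Strict Implicit.
Unset Printing Implicit Defensive.
Import Order.TTheory GRing.Theory Num.Theory.
Import numFieldNormedType.Exports.

Local Open Scope classical_set_scope.
Local Open Scope ring_scope.

(* ['rV[R]_n] stands for R^n and carries the product sigma-algebra of the Borel
   sigma-algebras of its coordinates, i.e. the Borel sigma-algebra of R^n. *)
Definition measure_rV_display : measure_display.
Proof. exact. Qed.

Section measurable_rV.
Context {R : realType} {n : nat}.

Definition rV_coord (i : 'I_n) (x : 'rV[R]_n) : measurableTypeR R := x 0 i.

Let rV_set0 : g_sigma_preimage rV_coord set0.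
Proof. exact: sigma_algebra0. Qed.

Let rV_setC A : g_sigma_preimage rV_coord A -> g_sigma_preimage rV_coord (~` A).
Proof. exact: sigma_algebraC. Qed.

Let rV_bigcup (F : (set 'rV[R]_n)^nat) :
  (forall i, g_sigma_preimage rV_coord (F i)) ->
  g_sigma_preimage rV_coord (\bigcup_i (F i)).
Proof. exact: sigma_algebra_bigcup. Qed.

HB.instance Definition _ := @isMeasurable.Build measure_rV_display
  'rV[R]_n (g_sigma_preimage rV_coord) rV_set0 rV_setC rV_bigcup.

Lemma measurable_rV_coord (i : 'I_n) : measurable_fun setT (rV_coord i).
Proof.
move=> _ Y mY; rewrite setTI; apply: sub_sigma_algebra => /=.
rewrite -bigcup_seq/=; exists i => /=; first by rewrite mem_index_enum.
by exists Y => //; rewrite setTI.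
Qed.

Lemma measurable_fun_rV d (T : measurableType d) (f : T -> 'rV[R]_n) :
  (forall i, measurable_fun setT (rV_coord i \o f)) -> measurable_fun setT f.
Proof.
move=> mf _ A mA; rewrite setTI.
suff : preimage_set_system setT f (g_sigma_preimage rV_coord) `<=` measurable.
  by apply; exists A => //; rewrite setTI.
rewrite -g_sigma_preimageE.
apply: smallest_sub; first exact: sigma_algebra_measurable.
move=> B [C + <-{B}].
rewrite -bigcup_seq => -[i _ [D mD <-{C}]].
rewrite setTI -(setTI (f @^-1` _)) setTI.
by rewrite setTI; have := mf i measurableT D mD; rewrite setTI.
Qed.

Lemma open_measurable_rV (U : set 'rV[R]_n) : open U -> measurable U.
Proof.
move=> oU.
pose q (v : 'rV[rat]_n * rat) : set 'rV[R]_n :=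
  [set x | forall i, `|ratr (v.1 0 i) - x 0 i| < ratr v.2].
have mq v : measurable (q v).
  have -> : q v = \big[setI/setT]_(i < n)
      (rV_coord i @^-1` (ball (ratr (v.1 0 i) : R) (ratr v.2))).
    apply/seteqP; split => x /=.
      by move=> h; rewrite -bigcap_seq => i _ /=; exact: h.
    by rewrite -bigcap_seq => h i; apply: (h i) => /=; rewrite mem_index_enum.
  apply: big_ind => //.
  - by move=> A B mA mB; exact: measurableI.
  - move=> i _.
    rewrite -[X in measurable X]setTI; apply: measurable_rV_coord => //.
    by rewrite ball_itv; exact: measurable_itv.
have -> : U = \bigcup_v (if `[< q v `<=` U >] then q v else set0).
  apply/seteqP; split; last first.
    by move=> x [v _]; case: ifPn => // /asboolP vU /vU.
  move=> x Ux.
  have /nbhs_ballP[e /= e0 eU] : nbhs x U by exact: open_nbhs_nbhs.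
  have e20 : 0 < e / 2 by rewrite divr_gt0.
  have [r] := rat_in_itvoo e20.
  rewrite in_itv /= => /andP[r0 re].
  have /choice[c cP] : forall i, exists c : rat, `|ratr c - x 0 i| < ratr r :> R.
    move=> i.
    have /rat_in_itvoo[c] : x 0 i < x 0 i + ratr r by rewrite ltrDl.
    rewrite in_itv /= => /andP[c1 c2]; exists c.
    by rewrite gtr0_norm ?subr_gt0// ltrBlDl.
  exists (\row_i c i, r) => //.
  case: ifPn => [_ i /=|/asboolP]; first by rewrite mxE.
  case => y yq; apply: eU; split => // i j; rewrite ord1.
  rewrite -ball_normE /= /ball_ /=.
  have := yq j; rewrite /= mxE => yj; have := cP j => xj.
  rewrite -(subrK (ratr (c j)) (x 0 j)) -addrA (le_lt_trans (ler_normD _ _))//.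
  rewrite [ltRHS](splitr e) ltrD//; apply: (lt_trans _ re) => //.
  by rewrite distrC.
apply: countable_bigcupT_measurable; first exact: countableP.
by move=> v; case: ifPn.
Qed.

Lemma measurable_cube (a b : R) :
  measurable [set x : 'rV[R]_n | forall i, a <= x 0 i <= b].
Proof.
rewrite (_ : [set x | _] = \big[setI/setT]_(i < n) (rV_coord i @^-1` ([set` `[a, b]%R] : set R))).
  apply: big_ind => //; first by move=> A B mA mB; exact: measurableI.
  move=> i _; rewrite -[X in measurable X]setTI; apply: measurable_rV_coord => //.
apply/seteqP; split => x /=.
  by move=> h; rewrite -bigcap_seq => i _ /=; rewrite in_itv /=; exact: h.
rewrite -bigcap_seq => h i; have := h i; rewrite /= in_itv /=; apply.
by rewrite mem_index_enum.
Qed.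

End measurable_rV.

Section cons_rV.
Context {R : realType} {n : nat}.

Definition cons_rV (z : measurableTypeR R * 'rV[R]_n) : 'rV[R]_(1 + n) :=
  row_mx (const_mx z.1) z.2.

Definition uncons_rV (x : 'rV[R]_(1 + n)) : measurableTypeR R * 'rV[R]_n :=
  (lsubmx x 0 0, rsubmx x).

Lemma cons_rVK : cancel cons_rV uncons_rV.
Proof. by move=> [a v]; rewrite /uncons_rV row_mxKl row_mxKr mxE. Qed.

Lemma uncons_rVK : cancel uncons_rV cons_rV.
Proof.
move=> x; rewrite /cons_rV /= -[RHS]hsubmxK; congr row_mx.
by apply/matrixP => i j; rewrite !ord1 !mxE.
Qed.

Lemma measurable_cons_rV : measurable_fun setT cons_rV.
Proof.
apply: (@measurable_fun_rV R (1 + n) _ (measurableTypeR R * 'rV[R]_n)%type) => i.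
case: (split_ordP i) => j ->.
  rewrite (_ : _ \o _ = fst); first exact: measurable_fst.
  by apply/funext => z; rewrite /rV_coord /cons_rV /= row_mxEl mxE.
rewrite (_ : _ \o _ = rV_coord j \o snd); last first.
  by apply/funext => z; rewrite /rV_coord /cons_rV /= row_mxEr.
by apply: measurableT_comp => //; exact: measurable_rV_coord.
Qed.

HB.instance Definition _ :=
  isMeasurableFun.Build _ _ _ _ cons_rV measurable_cons_rV.

Lemma measurable_uncons_rV : measurable_fun setT uncons_rV.
Proof.
apply/measurable_fun_pairP; split.
  rewrite (_ : _ \o _ = rV_coord (lshift n 0)); first exact: measurable_rV_coord.
  by apply/funext => z /=; rewrite mxE.
apply: measurable_fun_rV => i.
rewrite (_ : _ \o _ = rV_coord (rshift 1 i)); first exact: measurable_rV_coord.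
by apply/funext => z /=; rewrite /rV_coord /= mxE.
Qed.

Variable m : {sigma_finite_measure set 'rV[R]_n -> \bar R}.

(* Transport of (Lebesgue measure on R) x m along R x R^n = R^(1+n). *)
Definition lebesgue_cons : set 'rV[R]_(1 + n) -> \bar R :=
  pushforward (@lebesgue_measure R \x m)%E cons_rV.

Let lebesgue_cons0 : lebesgue_cons set0 = 0%E.
Proof. by rewrite /lebesgue_cons /pushforward preimage_set0 measure0. Qed.

Let lebesgue_cons_ge0 A : (0 <= lebesgue_cons A)%E.
Proof. exact: measure_ge0. Qed.

Let lebesgue_cons_sigma_additive : semi_sigma_additive lebesgue_cons.
Proof.
exact: (@measure_semi_sigma_additive _ _ _
  (measure_function_pushforward__canonical__measure_function_Measure
    (@lebesgue_measure R \x m)%E measurable_cons_rV)).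
Qed.

HB.instance Definition _ := isMeasure.Build _ _ _ lebesgue_cons
  lebesgue_cons0 lebesgue_cons_ge0 lebesgue_cons_sigma_additive.

Let lebesgue_cons_sigma_finite : sigma_finite setT lebesgue_cons.
Proof.
have [F FT Foo] := sigma_finiteT (@lebesgue_measure R).
have [G GT Goo] := sigma_finiteT m.
pose H (k : nat * nat) := uncons_rV @^-1` (F k.1 `*` G k.2).
exists (fun k => H (odflt (0, 0)%N (unpickle k))).
  apply/seteqP; split => // x _.
  have [k _ Fk] : (\bigcup_k F k) (uncons_rV x).1 by rewrite -FT.
  have [l _ Gl] : (\bigcup_k G k) (uncons_rV x).2 by rewrite -GT.
  by exists (pickle (k, l)) => //; rewrite pickleK.
move=> k; case: (odflt _ _) => {}k l.
have [mF Fk] := Foo k; have [mG Gl] := Goo l.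
split.
  rewrite -[X in measurable X]setTI; apply: measurable_uncons_rV => //.
  exact: measurableX.
rewrite /lebesgue_cons /pushforward -comp_preimage.
rewrite (_ : uncons_rV \o cons_rV = id); last first.
  by apply/funext => z /=; rewrite cons_rVK.
rewrite preimage_id product_measure1E// lte_mul_pinfty//.
by rewrite ge0_fin_numE.
Qed.

HB.instance Definition _ := @Measure_isSigmaFinite.Build _ _ _ lebesgue_cons
  lebesgue_cons_sigma_finite.

End cons_rV.

(* n-dimensional Lebesgue measure (R^0 is a point of mass 1). *)
Fixpoint lebesgue_rV (R : realType) (n : nat) :
    {sigma_finite_measure set 'rV[R]_n -> \bar R} :=
  match n with
  | 0%N => \d_(0 : 'rV[R]_0)
  | n'.+1 => lebesgue_cons (lebesgue_rV R n')
  end.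

(* [LspaceType mu p1] is the library's L^p space (functions modulo equality
   [mu]-almost everywhere), which comes without operations or topology.
   [Lclass] and [Lrepr] go from functions to classes and back, and serve to turn
   L^p into a normed module. *)
Section Lspace_class.
Context d (T : measurableType d) (R : realType).
Variables (mu : {measure set T -> \bar R}) (p : \bar R) (p1 : (1 <= p)%E).

Local Open Scope quotient_scope.

Local Notation Lf := (LfunType mu p1).
Local Notation Ls := (LspaceType mu p1).
Local Notation mf := {mfun T >-> measurableTypeR R}.
Local Notation mf_mu := {mfun_ mu, T >-> measurableTypeR R}.

Lemma eq_ae_Lnorm (f g : T -> R) : measurable_fun setT f ->
  measurable_fun setT g -> f = g %[ae mu] ->
  Lnorm mu p (EFin \o f) = Lnorm mu p (EFin \o g).
Proof.
move=> mf mg fg; rewrite unlock /Lnorm; case: p p1 => [r r1|_|//].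
- have mE (h : T -> R) : measurable_fun setT h ->
      measurable_fun setT ((fun x => `|(h x)%:E| `^ r)%E : T -> \bar R).
    move=> mh; apply: (measurableT_comp (measurable_poweR r) (g := abse \o (EFin \o h))).
    by apply: measurableT_comp => //; apply/measurable_EFinP.
  congr (_ `^ _)%E; apply: ae_eq_integral; [by []|exact: mE|exact: mE|].
  by move: fg; apply: filterS => x /= /[apply] ->.
- case: ifPn => // _; apply: eq_ess_sup.
  by move: fg; apply: filterS => x /= /(_ I) ->.
Qed.

Section Lclass.
Variable f : Lf.

Let measurable_f : @measurable_fun _ _ T (measurableTypeR R) setT f.
Proof. exact: (measurable_funPT f). Qed.

Let f_mfun : mf :=
  HB.pack (f : T -> measurableTypeR R)
    (isMeasurableFun.Build _ _ T (measurableTypeR R) f measurable_f).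

Let f_class : mf_mu := \pi_mf_mu f_mfun.

Let f_class_ae : (f_class : T -> R) = f %[ae mu].
Proof.
have : \pi_mf_mu (repr f_class) = \pi_mf_mu f_mfun by rewrite reprK.
by move=> /eqP; rewrite eqmodE => /asboolP.
Qed.

Let f_class_finite : finite_norm mu p (f_class : T -> R).
Proof.
rewrite /finite_norm (eq_ae_Lnorm _ _ f_class_ae)//.
- exact: Lfunction_finite.
- exact: (measurable_funPT (repr f_class)).
Qed.

Definition Lclass : Ls :=
  HB.pack f_class (isFinLebesgue.Build _ _ _ mu p p1 f_class f_class_finite).

Lemma LclassK : (Lclass : T -> R) = f %[ae mu].
Proof. exact: f_class_ae. Qed.

End Lclass.

Section Lrepr.
Variable v : Ls.

Let v_fun : T -> R := v.

Let measurable_v : measurable_fun setT v_fun.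
Proof. exact: (measurable_funPT (repr (v : mf_mu))). Qed.

Let v_fun_finite : finite_norm mu p v_fun.
Proof. exact: Lebesgue_finite. Qed.

Let v_mfun : {mfun T >-> R} :=
  HB.pack v_fun (isMeasurableFun.Build _ _ T R v_fun measurable_v).

Definition Lrepr : Lf :=
  HB.pack (v_mfun : T -> R) v_mfun
    (isLfunction.Build _ _ _ mu p p1 v_mfun v_fun_finite).

Lemma LreprE : (Lrepr : T -> R) = v.
Proof. by []. Qed.

End Lrepr.

Lemma Lspace_eqP (u v : Ls) : u = v <-> (u : T -> R) = v %[ae mu].
Proof.
split=> [->|uv]; first exact: ae_eq_refl.
have uvE : (u : mf_mu) = (v : mf_mu).
  by rewrite -[LHS]reprK -[RHS]reprK; apply/eqP; rewrite eqmodE; apply/asboolP.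
case: u v uvE {uv} => [u [[fu]]] [v [[fv]]] /= uvE; subst v.
by congr LebesgueSpace.Pack; congr LebesgueSpace.Class; congr isFinLebesgue.Axioms_.
Qed.

Lemma LreprK (v : Ls) : Lclass (Lrepr v) = v.
Proof. by apply/Lspace_eqP; exact: LclassK. Qed.

Lemma Lclass_eqP (f g : Lf) : Lclass f = Lclass g <-> (f : T -> R) = g %[ae mu].
Proof.
rewrite Lspace_eqP; split => h.
- exact: ae_eq_trans (ae_eq_sym (LclassK f)) (ae_eq_trans h (LclassK g)).
- exact: ae_eq_trans (LclassK f) (ae_eq_trans h (ae_eq_sym (LclassK g))).
Qed.

HB.instance Definition _ := gen_eqMixin Ls.
HB.instance Definition _ := gen_choiceMixin Ls.

End Lspace_class.
Arguments Lclass {d T R mu p p1} f : simpl never.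

Section Lspace_lmodule.
Context d (T : measurableType d) (R : realType).
Variables (mu : {measure set T -> \bar R}) (p : \bar R) (p1 : (1 <= p)%E).

Local Notation Lf := (LfunType mu p1).
Local Notation Ls := (LspaceType mu p1).

Let add (u v : Ls) : Ls := Lclass (Lrepr u + Lrepr v).
Let opp (u : Ls) : Ls := Lclass (- Lrepr u).
Let scale (a : R) (u : Ls) : Ls := Lclass (a *: Lrepr u).

Let addE (f g : Lf) : add (Lclass f) (Lclass g) = Lclass (f + g).
Proof.
apply/Lclass_eqP; have := LclassK g; have := LclassK f.
apply: filterS2 => x /(_ I) fx /(_ I) gx _.
by rewrite -[RHS]/(f x + g x) -fx -gx.
Qed.

Let oppE (f : Lf) : opp (Lclass f) = Lclass (- f).
Proof.
apply/Lclass_eqP; have := LclassK f.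
by apply: filterS => x /(_ I) fx _; rewrite -[RHS]/(- f x) -fx.
Qed.

Let scaleE a (f : Lf) : scale a (Lclass f) = Lclass (a *: f).
Proof.
apply/Lclass_eqP; have := LclassK f.
by apply: filterS => x /(_ I) fx _; rewrite -[RHS]/(a * f x) -fx.
Qed.

Let LclassP (P : Ls -> Prop) : (forall f, P (Lclass f)) -> forall u, P u.
Proof. by move=> h u; rewrite -(LreprK u); exact: h. Qed.

Let addA : associative add.
Proof.
elim/LclassP => f; elim/LclassP => g; elim/LclassP => h.
by rewrite !addE addrA.
Qed.

Let addC : commutative add.
Proof. by elim/LclassP => f; elim/LclassP => g; rewrite !addE addrC. Qed.

Let add0 : left_id (Lclass 0) add.
Proof. by elim/LclassP => f; rewrite addE add0r. Qed.

Let addN : left_inverse (Lclass 0) opp add.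
Proof. by elim/LclassP => f; rewrite oppE addE addNr. Qed.

HB.instance Definition _ := GRing.isZmodule.Build Ls addA addC add0 addN.

Let scaleA a b v : scale a (scale b v) = scale (a * b) v.
Proof. by elim/LclassP: v => f; rewrite !scaleE scalerA. Qed.

Let scale1 : left_id 1 scale.
Proof. by elim/LclassP => f; rewrite scaleE scale1r. Qed.

Let scaleDr : right_distributive scale +%R.
Proof.
move=> a; elim/LclassP => f; elim/LclassP => g.
by rewrite [f in scale a f]addE !scaleE [RHS]addE scalerDr.
Qed.

Let scaleDl v : {morph scale^~ v : a b / a + b}.
Proof.
elim/LclassP: v => f a b.
by rewrite !scaleE [RHS]addE scalerDl.
Qed.

HB.instance Definition _ := GRing.Zmodule_isLmodule.Build R Ls
  scaleA scale1 scaleDr scaleDl.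

Lemma LclassD (f g : Lf) : Lclass (f + g) = Lclass f + Lclass g.
Proof. by rewrite [RHS]addE. Qed.

Lemma LclassZ a (f : Lf) : Lclass (a *: f) = a *: Lclass f.
Proof. by rewrite [RHS]scaleE. Qed.

Let norm (u : Ls) : R := fine (Lnorm mu p (EFin \o (u : T -> R))).

Let normE (f : Lf) : norm (Lclass f) = fine (Lnorm mu p (EFin \o f)).
Proof.
congr fine; apply: (eq_ae_Lnorm p1 _ _ (LclassK f)).
- exact: (measurable_funPT (Lrepr (Lclass f))).
- exact: (measurable_funPT f).
Qed.

Let norm_triangle u v : norm (u + v) <= norm u + norm v.
Proof.
elim/LclassP: u => f; elim/LclassP: v => g.
by rewrite -LclassD !normE; exact: ler_LnormD.
Qed.

Let normZ (a : R) v : norm (a *: v) = `|a| * norm v.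
Proof.
elim/LclassP: v => f; rewrite -LclassZ !normE.
apply: EFin_inj; rewrite EFinM !finite_norm_fine.
exact: LnormZ.
Qed.

Let norm0_eq0 v : norm v = 0 -> v = 0.
Proof.
elim/LclassP: v => f; rewrite normE => /fine_Lnormr_eq0 f0.
exact/Lclass_eqP.
Qed.

HB.instance Definition _ := Lmodule_isNormed.Build R Ls
  norm_triangle normZ norm0_eq0.

Lemma Lspace_normE (u : Ls) : `|u| = fine (Lnorm mu p (EFin \o (u : T -> R))).
Proof. by []. Qed.

End Lspace_lmodule.

Notation borel T := (g_sigma_algebraType (@open T)).

Notation L2 mu := (LspaceType mu (lee1n 2)).

Definition separable (T : topologicalType) :=
  exists2 A : set T, countable A & dense A.

(* The library's norm on ['rV] is the sup norm, hence this definition. *)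
Definition l2norm (R : realType) (p : nat) (x : 'rV[R]_p) : R :=
  Num.sqrt (\sum_(k < p) x 0 k ^+ 2).

(* Best Lipschitz constant of [f] for the norms [nU] and [nV]. *)
Definition Lip (R : realType) (U V : zmodType) (nU : U -> R) (nV : V -> R)
    (f : U -> V) : \bar R :=
  ereal_sup [set (nV (f z.1 - f z.2) / nU (z.1 - z.2))%:E
            | z in [set z : U * U | z.1 != z.2]].

Section domain.
Context {R : realType} {d : nat}.
Implicit Types D : set 'rV[R]_d.

(* A domain is a nonempty connected open set; a compact domain is the closure of
   a domain, and compact. *)
Definition compact_domain D := compact D /\
  exists U : set 'rV[R]_d, [/\ open U, connected U, U !=set0 & D = closure U].

Lemma measurable_compact_domain D : compact_domain D -> measurable D.
Proof.
move=> [cD _]; rewrite -(setCK D); apply: measurableC; apply: open_measurable_rV.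
by rewrite openC; apply: compact_closed => //; exact: norm_hausdorff.
Qed.

Definition domain_measure D (hD : compact_domain D) :=
  mrestr (lebesgue_rV R d) (measurable_compact_domain hD).

HB.instance Definition _ D (hD : compact_domain D) :=
  Measure.copy (domain_measure hD)
    (mrestr (lebesgue_rV R d) (measurable_compact_domain hD)).

End domain.

Section torus.
Variables (R : realType) (n : nat).

(* T^n is identified with [0, 2 pi]^n, with the (unnormalized) Lebesgue measure. *)
Definition torus : set 'rV[R]_n := [set x | forall i, 0 <= x 0 i <= 2 * pi].

Lemma measurable_torus : measurable torus.
Proof. exact: measurable_cube. Qed.

Definition torus_measure := mrestr (lebesgue_rV R n) measurable_torus.

HB.instance Definition _ := Measure.copy torus_measure
  (mrestr (lebesgue_rV R n) measurable_torus).

End torus.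
Arguments torus : clear implicits.
Arguments torus_measure : clear implicits.

Section hilbert.
Context d (T : measurableType d) (R : realType) (mu : {measure set T -> \bar R}).

Definition inner (u v : L2 mu) : R := \int[mu]_x (u x * v x).

Definition linearly_independent (p : nat) (tau : 'I_p -> L2 mu) :=
  forall c : 'rV[R]_p, \sum_(k < p) c 0 k *: tau k = 0 -> c = 0.

Definition dual_basis (p : nat) (tau taus : 'I_p -> L2 mu) :=
  (forall k, exists c : 'rV[R]_p, taus k = \sum_(l < p) c 0 l *: tau l) /\
  (forall l k, inner (tau l) (taus k) = (l == k)%:R).

(* There is no constant term: the bias component tau_0 is identically 0. *)
Definition reconstruction (p : nat) (tau : 'I_p -> L2 mu) (a : 'rV[R]_p) : L2 mu :=
  \sum_(k < p) a 0 k *: tau k.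

(* The optimal projection is obtained with [taus] the dual basis of [tau]. *)
Definition projection (p : nat) (taus : 'I_p -> L2 mu) (v : L2 mu) : 'rV[R]_p :=
  \row_(k < p) inner v (taus k).

(* [nu] is the measure on L^2 against which the error is averaged, namely the
   push-forward of the input measure by the operator. *)
Definition reconstruction_error (p : nat) (nu : set (borel (L2 mu)) -> \bar R)
    (Rec : 'rV[R]_p -> L2 mu) (P : L2 mu -> 'rV[R]_p) : \bar R :=
  ((\int[nu]_v (`|Rec (P v) - v| ^+ 2)%:E) `^ 2^-1)%E.

End hilbert.

Section sobolev.
Context {R : realType} {n : nat}.
Implicit Types (v : L2 (torus_measure R n)) (k : 'rV[int]_n).

Definition phase k (x : 'rV[R]_n) : R := \sum_(i < n) (k 0 i)%:~R * x 0 i.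

(* (2 pi)^(-n) int_{T^n} v(x) exp(- i k.x) dx *)
Definition fourier_coef v k : R[i] := Complex
  ((2 * pi) ^- n * \int[torus_measure R n]_x (v x * cos (phase k x)))
  (- ((2 * pi) ^- n * \int[torus_measure R n]_x (v x * sin (phase k x)))).

(* ||v||_{H^s}^2 = (2 pi)^n sum_{k in Z^n} (1 + |k|^2)^s |v^(k)|^2, with values in
   [0, +oo]: H^s(T^n) is the set of the v in L^2(T^n) where it is finite.
   With this normalization H^0 = L^2 isometrically. *)
Definition Hs_norm (s : R) v : \bar R :=
  ((((2 * pi) ^+ n)%:E * \esum_(k in [set: 'rV[int]_n])
     ((1 + \sum_(i < n) (k 0 i)%:~R ^+ 2) `^ s *
      Normc.normc (fourier_coef v k) ^+ 2)%:E) `^ 2^-1)%E.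

End sobolev.

Section relu_net.
Variable R : realType.

(* A network C_K o relu o ... o relu o C_1; its affine maps act on row vectors,
   x |-> x W + b. There is one hidden layer per occurrence of relu. *)
Inductive relu_net : nat -> nat -> Type :=
| OutputLayer m n of 'M[R]_(m, n) & 'rV[R]_n : relu_net m n
| HiddenLayer m k n of 'M[R]_(m, k) & 'rV[R]_k & relu_net k n : relu_net m n.

Definition affine m n (W : 'M[R]_(m, n)) (b : 'rV[R]_n) (x : 'rV[R]_m) :=
  x *m W + b.

Definition relu n (x : 'rV[R]_n) : 'rV[R]_n := map_mx (Num.max ^~ 0) x.

Fixpoint net_eval m n (N : relu_net m n) : 'rV[R]_m -> 'rV[R]_n :=
  match N with
  | OutputLayer _ _ W b => affine W b
  | HiddenLayer _ _ _ W b N' => fun x => net_eval N' (relu (affine W b x))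
  end.

Definition nnz m n (A : 'M[R]_(m, n)) : nat :=
  #|[pred ij : 'I_m * 'I_n | A ij.1 ij.2 != 0]|.

Fixpoint net_size m n (N : relu_net m n) : nat :=
  match N with
  | OutputLayer _ _ W b => nnz W + nnz b
  | HiddenLayer _ _ _ W b N' => nnz W + nnz b + net_size N'
  end.

Fixpoint net_depth m n (N : relu_net m n) : nat :=
  match N with
  | OutputLayer _ _ _ _ => 0
  | HiddenLayer _ _ _ _ _ N' => (net_depth N').+1
  end.

Lemma measurable_affine m n (W : 'M[R]_(m, n)) b :
  measurable_fun setT (affine W b).
Proof.
apply: measurable_fun_rV => i.
rewrite (_ : _ \o _ = fun x => \sum_(j < m) rV_coord j x * W j i + b 0 i).
  apply: measurable_funD => //; apply: measurable_sum => j.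
  by apply: measurable_funM => //; exact: measurable_rV_coord.
by apply/funext => x; rewrite /rV_coord /affine /= !mxE.
Qed.

Lemma measurable_relu n : measurable_fun setT (@relu n).
Proof.
apply: measurable_fun_rV => i.
rewrite (_ : _ \o _ = fun x => Num.max (rV_coord i x) 0).
  by apply: measurable_maxr => //; exact: measurable_rV_coord.
by apply/funext => x; rewrite /rV_coord /relu /= !mxE.
Qed.

Lemma measurable_net_eval m n (N : relu_net m n) : measurable_fun setT (net_eval N).
Proof.
elim: N => [{}m {}n W b|{}m k {}n W b N IH] /=; first exact: measurable_affine.
apply: (measurableT_comp IH); apply: measurableT_comp.
- exact: measurable_relu.
- exact: measurable_affine.
Qed.

Lemma affine_bounded m n (W : 'M[R]_(m, n)) b (B : R) : exists C : R,
  forall x : 'rV[R]_m, (forall i, `|x 0 i| <= B) -> forall i, `|affine W b x 0 i| <= C.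
Proof.
exists (\sum_(i < n) (\sum_(j < m) B * `|W j i| + `|b 0 i|)) => x xB i.
have B0 (j : 'I_m) : 0 <= B by exact: le_trans (xB j).
rewrite (bigD1 i)//= /affine !mxE.
rewrite (le_trans (ler_normD _ _))// -[leLHS]addr0 lerD//.
  rewrite lerD// (le_trans (ler_norm_sum _ _ _))//.
  by apply: ler_sum => j _; rewrite normrM ler_wpM2r.
by apply: sumr_ge0 => j _; rewrite addr_ge0// sumr_ge0// => l _; rewrite mulr_ge0 ?B0.
Qed.

Lemma net_eval_bounded m n (N : relu_net m n) (B : R) : exists C : R,
  forall x : 'rV[R]_m, (forall i, `|x 0 i| <= B) -> forall i, `|net_eval N x 0 i| <= C.
Proof.
elim: N B => [{}m {}n W b|{}m k {}n W b N IH] B /=; first exact: affine_bounded.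
have [B1 hB1] := affine_bounded W b B.
have [C hC] := IH B1; exists C => x /hB1 xB; apply: hC => i.
rewrite mxE (le_trans _ (xB i))// maxEle; case: ifPn => // _.
by rewrite normr0.
Qed.

End relu_net.

Lemma lebesgue_rV_cube (R : realType) (n : nat) (a b : R) : a <= b ->
  lebesgue_rV R n [set x | forall i, a <= x 0 i <= b] = ((b - a) ^+ n)%:E.
Proof.
move=> ab; elim: n => [|n IH] /=.
  by rewrite diracE mem_set//=; case.
rewrite /lebesgue_cons /pushforward.
rewrite (_ : _ @^-1` _ = [set` `[a, b]%R] `*`
    [set x : 'rV[R]_n | forall i, a <= x 0 i <= b]).
  rewrite product_measure1E//; last exact: measurable_cube.
  rewrite /= IH lebesgue_measure_itv /= lte_fin exprS EFinM.
  by case: ltgtP ab => // -> _; rewrite subrr.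
apply/seteqP; split => -[t x] /=; rewrite /cons_rV /= in_itv /=.
  move=> h; split.
    by have := h (lshift n (0 : 'I_1)); rewrite (@row_mxEl _ 1 1 n) mxE.
  by move=> i; have := h (rshift 1 i : 'I_(1 + n)); rewrite (@row_mxEr _ 1 1 n).
move=> [ht hx] i; case: (@split_ordP 1 n i) => j ->.
  by rewrite (@row_mxEl _ 1 1 n) mxE.
by rewrite (@row_mxEr _ 1 1 n).
Qed.

Section trunk.
Variables (R : realType) (n p : nat) (N : relu_net R n p) (k : 'I_p).

Let tau (x : 'rV[R]_n) : R := net_eval N x 0 k.

Let measurable_tau : measurable_fun setT tau.
Proof.
apply: (@measurableT_comp _ _ _ _ _ _ (rV_coord k)).
- exact: measurable_rV_coord.
- exact: measurable_net_eval.
Qed.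

Let tau_finite : finite_norm (torus_measure R n) 2 tau.
Proof.
have [C hC] := net_eval_bounded N (2 * pi : R).
have torus_fin : (torus_measure R n setT < +oo)%E.
  rewrite /torus_measure /mrestr setTI /torus.
  by rewrite lebesgue_rV_cube ?ltry// mulr_ge0// pi_ge0.
have torus_ae : {ae torus_measure R n, forall x, torus R n x}.
  exists (~` torus R n); split => //; first by apply: measurableC; exact: measurable_torus.
  by rewrite /torus_measure /mrestr setICl (measure0 (lebesgue_rV R n)).
rewrite /finite_norm unlock /Lnorm; apply: poweR_lty.
pose K := Num.max C 0.
have mE : measurable_fun setT (fun x : 'rV[R]_n => (`|tau x| `^ 2)%:E).
  apply/measurable_EFinP; apply: (measurableT_comp (measurable_powR 2)).
  exact: measurableT_comp.
apply: (@le_lt_trans _ _ ((K `^ 2)%:E * torus_measure R n setT)%E); last first.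
  by rewrite lte_mul_pinfty// lee_fin powR_ge0.
apply: le_trans (integral_le_bound (K `^ 2)%:E measurableT mE _ _); last 2 first.
- by rewrite lee_fin powR_ge0.
- move: torus_ae; apply: filterS => x tx _.
  rewrite gee0_abs ?lee_fin ?powR_ge0// ge0_ler_powR ?nnegrE ?le_max ?lexx ?orbT//.
  rewrite hC// => i; have /andP[x0 x1] := tx i.
  by rewrite ger0_norm.
- rewrite le_eqVlt; apply/orP; left; apply/eqP; apply: eq_integral => x _.
  by rewrite [RHS]gee0_abs// lee_fin powR_ge0.
Qed.

Let tau_mfun : {mfun 'rV[R]_n >-> R} :=
  HB.pack tau (isMeasurableFun.Build _ _ 'rV[R]_n R tau measurable_tau).

Let tau_Lfun : LfunType (torus_measure R n) (lee1n 2) :=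
  HB.pack (tau_mfun : 'rV[R]_n -> R) tau_mfun
    (isLfunction.Build _ _ _ (torus_measure R n) _ (lee1n 2) tau_mfun tau_finite).

(* The class in L^2(T^n) of the [k]-th component of the network. *)
Definition trunk : L2 (torus_measure R n) := Lclass tau_Lfun.

Lemma trunkE : (trunk : 'rV[R]_n -> R) = (fun x => net_eval N x 0 k)
  %[ae torus_measure R n].
Proof. exact: LclassK. Qed.

End trunk.

(* Main.v *)
(* The real trigonometric functions cas (k.x) = cos (k.x) + sin (k.x), for k in
   Z^n, normalised by (2 pi)^(-n/2), form an orthonormal system of L2 of the
   torus (the Hartley basis), and <v, cas (k.x)>^2 is controlled by the squared
   modulus of the k-th Fourier coefficient.  The system is complete: the
   polynomials (1 - t^m)^(2^m) tend to the indicator of t < 1/2 on [0, 1], so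
   composing them with trigonometric polynomials gives indicators of boxes, and a
   pi-lambda argument gives all indicators.  Taking p frequencies between two
   consecutive boxes, the best approximation of v in their span has error at most
   a constant times p^(-s/n) times the H^s norm of v.

   All basis functions are one fixed function of an affine form of x, since
   cas y is affine in sin^2 of an affine function of y.  A ReLU net computes sin^2
   by range reduction: sin^2 z is close to z^2 for small z, and
   sin^2 (2 z) = 4 h (sin^2 z) with h u = u - u^2, where h is the sum of the
   iterated tent maps divided by powers of 4.  With O(log p) doublings and
   O(log p) tent maps for each, the p outputs are so close to the basis that they
   are nearly orthonormal: synthesis and dual analysis have norm at most 2, and
   R o P is the orthogonal projection onto their span, hence at least as good as
   the combination of the outputs with the Hartley coefficients of v. *)

Require Import Defs.
From HB Require Import structures.
From mathcomp Require Import all_boot all_order all_algebra.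
From mathcomp Require Import all_classical all_reals all_analysis.
From mathcomp Require Import measurable_realfun ess_sup_inf complex.
From mathcomp Require Import ring lra zify.
Set Implicit Arguments.
Unset Strict Implicit.
Unset Printing Implicit Defensive.
Import Order.TTheory GRing.Theory Num.Theory.
Import numFieldNormedType.Exports.

Local Open Scope classical_set_scope.
Local Open Scope ring_scope.

(** * The tent map and the squared sine *)

Section tent_map.
Context (R : realType).
Implicit Types (t u v w x y : R) (r m : nat).

(** One kink, at 1/2, beside a linear term: a form that a single ReLU layer evaluates exactly. *)
Definition tent t : R := 2 * t - 4 * Num.max (t - 2^-1) 0.

Lemma tent_itv t : 0 <= t <= 1 -> 0 <= tent t <= 1.
Proof. by rewrite /tent; case: (leP (t - 2^-1) 0) => h /andP[t0 t1]; lra. Qed.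

Definition hump u : R := u - u ^+ 2.

Lemma hump_itv u : 0 <= u <= 1 -> 0 <= hump u <= 4^-1.
Proof.
move=> /andP[u0 u1]; have := sqr_ge0 (u - 2^-1); have : 0 <= u * (1 - u).
  by rewrite mulr_ge0 ?subr_ge0.
by rewrite /hump; lra.
Qed.

(* On each of its two linear pieces, [tent] halves the parabola [hump]. *)
Lemma hump_tent t : hump t = (tent t + hump (tent t)) / 4.
Proof.
by rewrite /tent /hump; case: (leP (t - 2^-1) 0) => h; rewrite ?subr0 ?mulr0; field.
Qed.

(** [hump_tent] unrolled [r] times, with the last [hump] replaced by 0: the sum of tent^k(t) / 4^k
    for 1 <= k <= r, a Takagi-like series with ratio 1/4 in place of 1/2. *)
Fixpoint takagi r t : R :=
  if r is r'.+1 then (tent t + takagi r' (tent t)) / 4 else 0.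

(** The truncation drops hump(tent^r(t)) / 4^r, and [hump] maps [0, 1] into [0, 1/4]. That the error
    is one-sided keeps the iterates of [4 * takagi r] inside [0, 1]. *)
Lemma takagi_hump r t : 0 <= t <= 1 -> 0 <= hump t - takagi r t <= (4^-1) ^+ r.+1.
Proof.
elim: r t => [|r IH] t t01 /=; first by rewrite subr0 expr1; exact: hump_itv.
have /andP[h0 h1] := IH _ (tent_itv t01); rewrite (hump_tent t).
by rewrite exprS; move: ((4^-1) ^+ r.+1) h1 => e h1; apply/andP; split; lra.
Qed.

Lemma takagi_ge0 r t : 0 <= t <= 1 -> 0 <= takagi r t.
Proof.
elim: r t => [//|r IH] t t01 /=.
have := IH _ (tent_itv t01); have /andP[] := tent_itv t01; lra.
Qed.

Lemma takagi4_itv r t : 0 <= t <= 1 -> 0 <= 4 * takagi r t <= 1.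
Proof.
move=> t01; have := takagi_ge0 r t01; have /andP[h0 h1] := takagi_hump r t01.
by have /andP[_] := hump_itv t01; lra.
Qed.

Lemma iter_takagi4_itv r m u : 0 <= u <= 1 -> 0 <= iter m (fun v => 4 * takagi r v) u <= 1.
Proof. by move=> u01; elim: m => [//|m IH]; exact: takagi4_itv. Qed.

(** The difference factors as 4 (u - v) (1 - (u + v)), whose last factor has modulus at most 1.
    Hence one angle doubling multiplies an error by at most 4. *)
Lemma hump_lip u v : 0 <= u <= 1 -> 0 <= v <= 1 -> `|4 * hump u - 4 * hump v| <= 4 * `|u - v|.
Proof.
move=> /andP[u0 u1] /andP[v0 v1].
have -> : 4 * hump u - 4 * hump v = 4 * ((u - v) * (1 - (u + v))) by rewrite /hump; ring.
rewrite normrM ger0_norm// ler_wpM2l// normrM -[leRHS]mulr1 ler_wpM2l//.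
by rewrite ler_norml; lra.
Qed.

(** Since sin^2(2 x) = 4 sin^2(x) cos^2(x), the logistic map v -> 4 v (1 - v) doubles the angle of a
    squared sine. *)
Lemma sin_sqr_double m x : sin (2 ^+ m * x) ^+ 2 = iter m (fun v => 4 * hump v) (sin x ^+ 2).
Proof.
elim: m => [|m IH]; first by rewrite mul1r.
rewrite iterS -IH /hump.
have -> : 2 ^+ m.+1 * x = (2 ^+ m * x) *+ 2 by rewrite exprS -mulrA mulr_natl.
rewrite sin_mulr2n.
have := cos2Dsin2 (2 ^+ m * x); move: (sin _) (cos _) => a b ba.
have -> : (b * a *+ 2) ^+ 2 = 4 * (b ^+ 2 * a ^+ 2) by ring.
have -> : b ^+ 2 = 1 - a ^+ 2 by rewrite -ba addrK.
by ring.
Qed.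

Lemma sin_sqr_itv x : 0 <= sin x ^+ 2 <= 1.
Proof. by rewrite sqr_ge0 -[leRHS](cos2Dsin2 x) lerDr sqr_ge0. Qed.

Lemma sin_le_id x : 0 <= x -> sin x <= x.
Proof.
rewrite le_eqVlt => /predU1P[<-|x0]; first by rewrite sin0.
have [] := @MVT R (@sin R) (@cos R) 0 x x0.
  by apply: continuous_subspaceT => y; exact: continuous_sin.
move=> c _; rewrite sin0 !subr0 => ->.
by rewrite -[leRHS]mul1r ler_wpM2r ?cos_le1// ltW.
Qed.

(** Half-angle formula cos x = 1 - 2 sin^2(x / 2), followed by [sin_le_id]. *)
Lemma cos_ge_quad x : 0 <= x <= 1 -> 1 - x ^+ 2 / 2 <= cos x.
Proof.
move=> /andP[x0 x1].
have -> : cos x = 1 - 2 * sin (x / 2) ^+ 2.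
  have -> : cos x = cos ((x / 2) *+ 2) by rewrite -mulr_natl mulrCA mulfV ?mulr1.
  rewrite cos_mulr2n; have := cos2Dsin2 (x / 2).
  by move=> /(canRL (addrK _)) ->; ring.
have h0 : 0 <= sin (x / 2) by apply: sin_ge0_pi; have := pi_ge2 R; lra.
have h1 : sin (x / 2) <= x / 2 by apply: sin_le_id; lra.
have : sin (x / 2) ^+ 2 <= (x / 2) ^+ 2 by rewrite ler_sqr ?nnegrE//; lra.
by rewrite exprMn exprVn; lra.
Qed.

(** The mean value theorem gives sin x = x cos c with 0 < c < x, and [cos_ge_quad] bounds cos c. *)
Lemma sin_ge_cubic x : 0 <= x <= 1 -> x - x ^+ 3 / 2 <= sin x.
Proof.
move=> /andP[]; rewrite le_eqVlt => /predU1P[<-|x0] x1.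
  by rewrite sin0 expr0n mul0r subr0.
have [] := @MVT R (@sin R) (@cos R) 0 x x0.
  by apply: continuous_subspaceT => y; exact: continuous_sin.
move=> c; rewrite in_itv/= sin0 !subr0 => /andP[c0 cx] ->.
have : 1 - c ^+ 2 / 2 <= cos c by apply: cos_ge_quad; lra.
have : c ^+ 2 <= x ^+ 2 by rewrite ler_sqr ?nnegrE; lra.
move=> h1 h2; rewrite [leLHS](_ : _ = (1 - x ^+ 2 / 2) * x); last by field.
by rewrite ler_wpM2r; lra.
Qed.

(** The difference of squares factors into x - sin x, at most x^3 / 2, and x + sin x, at most 2
    x. *)
Lemma sin_sqr_approx x : 0 <= x <= 1 -> `|sin x ^+ 2 - x ^+ 2| <= x ^+ 4.
Proof.
move=> x01; have /andP[x0 x1] := x01; rewrite distrC.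
have s0 : 0 <= sin x by apply: sin_ge0_pi; have := pi_ge2 R; lra.
have s1 := sin_le_id x0; have s2 := sin_ge_cubic x01.
have -> : x ^+ 2 - sin x ^+ 2 = (x - sin x) * (x + sin x) by ring.
rewrite ger0_norm ?mulr_ge0 ?subr_ge0 ?addr_ge0//.
rewrite [leRHS](_ : _ = (x ^+ 3 / 2) * (2 * x)); last by field.
by apply: ler_pM; lra.
Qed.

(* Range reduction by repeated doubling: [sin^2 (2 z) = 4 hump (sin^2 z)]. *)
Lemma sin_sqr_net_error m r x : 0 <= x <= 1 ->
  `|iter m (fun v => 4 * takagi r v) (x - takagi r x) - sin (2 ^+ m * x) ^+ 2| <=
  4 ^+ m * (x ^+ 4 + 2 * (4^-1) ^+ r).
Proof.
move=> x01; rewrite sin_sqr_double.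
set e := (4^-1) ^+ r.
have e0 : 0 <= e by rewrite exprn_ge0.
have e4 : (4^-1) ^+ r.+1 = e / 4 by rewrite exprS mulrC.
have u01 : 0 <= x - takagi r x <= 1.
  have := takagi_ge0 r x01; have /andP[h0 _] := takagi_hump r x01.
  by move: x01 h0 => /andP[x0 x1]; rewrite /hump; have := sqr_ge0 x; lra.
(* Strengthened for the induction: a round turns an error E into at most 4 E + e, so E + e grows by
   a factor of at most 4. *)
suff : `|iter m (fun v => 4 * takagi r v) (x - takagi r x) -
    iter m (fun v => 4 * hump v) (sin x ^+ 2)| + e <= 4 ^+ m * (x ^+ 4 + 2 * e).
  by apply: le_trans; rewrite lerDl.
elim: m => [|m IH] /=.
  rewrite mul1r.
  have h1 := sin_sqr_approx x01.
  (* [x - hump x] is x^2, so the starting value is off by one [takagi] error. *)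
  have : `|x - takagi r x - x ^+ 2| <= e / 4.
    have := takagi_hump r x01; rewrite e4 /hump => /andP[h2 h3].
    by rewrite ler_norml; lra.
  have := ler_distD (x ^+ 2) (x - takagi r x) (sin x ^+ 2).
  rewrite (distrC (x ^+ 2) (sin _ ^+ 2)).
  by lra.
move: IH; rewrite (exprS 4 m) -mulrA; set u := iter m _ _; set v := iter m _ _.
move: (4 ^+ m * _) => B IH.
have u1 : 0 <= u <= 1 by exact: iter_takagi4_itv.
have v1 : 0 <= v <= 1 by rewrite /v -sin_sqr_double; exact: sin_sqr_itv.
have := hump_lip u1 v1.
have : `|4 * takagi r u - 4 * hump u| <= e.
  have := takagi_hump r u1; rewrite e4 => /andP[h2 h3].
  by rewrite ler_norml; lra.
have := ler_distD (4 * hump u) (4 * takagi r u) (4 * hump v).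
by lra.
Qed.

End tent_map.

(** * ReLU networks *)

Section net_parallel.
Context (R : realType).

Lemma nnzE m n (A : 'M[R]_(m, n)) : nnz A = (\sum_(i < m) \sum_(j < n) (A i j != 0%R))%N.
Proof.
rewrite pair_big /= /nnz -sum1_card.
by rewrite [LHS]big_mkcond /=; apply: eq_bigr => -[i j] _; rewrite inE /=; case: eqP.
Qed.

Lemma nnz_le m n (A : 'M[R]_(m, n)) : (nnz A <= m * n)%N.
Proof. by rewrite /nnz (leq_trans (max_card _))// card_prod !card_ord. Qed.

Lemma nnz0 m n : nnz (0 : 'M[R]_(m, n)) = 0%N.
Proof. by rewrite nnzE !big1// => i _; rewrite big1// => j _; rewrite mxE eqxx. Qed.

Lemma nnz_row_mx m n1 n2 (A : 'M[R]_(m, n1)) (B : 'M[R]_(m, n2)) :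
  nnz (row_mx A B) = (nnz A + nnz B)%N.
Proof.
rewrite !nnzE -big_split/=; apply: eq_bigr => i _.
by rewrite big_split_ord; congr (_ + _)%N; apply: eq_bigr => j _;
  rewrite ?row_mxEl ?row_mxEr.
Qed.

Lemma nnz_col_mx m1 m2 n (A : 'M[R]_(m1, n)) (B : 'M[R]_(m2, n)) :
  nnz (col_mx A B) = (nnz A + nnz B)%N.
Proof.
rewrite !nnzE big_split_ord; congr (_ + _)%N; apply: eq_bigr => i _;
  by apply: eq_bigr => j _; rewrite ?col_mxEu ?col_mxEd.
Qed.

Lemma nnz_block_diag m1 m2 n1 n2 (A : 'M[R]_(m1, n1)) (B : 'M[R]_(m2, n2)) :
  nnz (block_mx A 0 0 B) = (nnz A + nnz B)%N.
Proof. by rewrite nnz_col_mx !nnz_row_mx !nnz0 addn0. Qed.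

Lemma affine_block_diag m1 m2 n1 n2 (A : 'M[R]_(m1, n1)) (B : 'M[R]_(m2, n2)) a b x y :
  affine (block_mx A 0 0 B) (row_mx a b) (row_mx x y) =
  row_mx (affine A a x) (affine B b y).
Proof. by rewrite /affine mul_row_block !mulmx0 addr0 add0r add_row_mx. Qed.

Lemma relu_row_mx n1 n2 (x : 'rV[R]_n1) (y : 'rV[R]_n2) :
  relu (row_mx x y) = row_mx (relu x) (relu y).
Proof. exact: map_row_mx. Qed.

(** Every layer becomes block diagonal. The zero blocks do not count, so sizes add up exactly; equal
    depths let the layers be paired one by one. *)
Lemma net_block_diag m1 n1 (N1 : relu_net R m1 n1) m2 n2 (N2 : relu_net R m2 n2) :
  net_depth N1 = net_depth N2 -> exists N : relu_net R (m1 + m2) (n1 + n2),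
  [/\ forall x y, net_eval N (row_mx x y) = row_mx (net_eval N1 x) (net_eval N2 y),
      net_size N = (net_size N1 + net_size N2)%N & net_depth N = net_depth N1].
Proof.
elim: N1 m2 n2 N2 => [{}m1 {}n1 W b|{}m1 k1 {}n1 W b N1 IH] m2 n2
  [{}m2 {}n2 W' b'|{}m2 k2 {}n2 W' b' N2]//=.
  move=> _; exists (OutputLayer (block_mx W 0 0 W') (row_mx b b')); split => //=.
    by move=> x y; rewrite affine_block_diag.
  by rewrite nnz_block_diag nnz_row_mx addnACA.
move=> [/IH[N [Ne Ns Nd]]].
exists (HiddenLayer (block_mx W 0 0 W') (row_mx b b') N); split => /=.
- by move=> x y; rewrite affine_block_diag relu_row_mx Ne.
- by rewrite nnz_block_diag nnz_row_mx Ns; ring.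
- by rewrite Nd.
Qed.

(** Base case for [net_parallel]: with no output, the depth must still be the prescribed one. *)
Lemma empty_net r : exists N : relu_net R 0 0, net_size N = 0%N /\ net_depth N = r.
Proof.
elim: r => [|r [N [Ns Nd]]].
  by exists (OutputLayer 0 0); rewrite /= !nnz0.
by exists (HiddenLayer 0 0 N); rewrite /= !nnz0 Ns Nd.
Qed.

(* The scalar nets share their input, and each has its own first affine map. *)
Lemma net_parallel n q (B : relu_net R q 1) p (W : 'I_p -> 'M[R]_(n, q))
    (b : 'I_p -> 'rV[R]_q) : exists N : relu_net R n p,
  [/\ forall x k, net_eval N x 0 k = net_eval B (relu (affine (W k) (b k) x)) 0 0,
      (net_size N <= p * (n * q + q + net_size B))%N &
      net_depth N = (net_depth B).+1].
Proof.
(* The first affine map [V], [c] is kept apart: all blocks read the same input there, so only the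
   later layers are block diagonal. *)
suff [m [V [c [N [Ne Vs Ns Nd]]]]] : exists m (V : 'M[R]_(n, m)) (c : 'rV[R]_m)
    (N : relu_net R m p), [/\ forall x k, net_eval N (relu (affine V c x)) 0 k =
        net_eval B (relu (affine (W k) (b k) x)) 0 0,
      (nnz V + nnz c <= p * (n * q + q))%N,
      net_size N = (p * net_size B)%N & net_depth N = net_depth B].
  exists (HiddenLayer V c N); split => //=; last by rewrite Nd.
  by rewrite mulnDr Ns leq_add2r.
elim: p W b => [|p IH] W b.
  have [N [Ns Nd]] := empty_net (net_depth B).
  by exists 0, 0, 0, N; split => //; [move=> x []|rewrite !nnz0].
have [m [V [c [N [Ne Vs Ns Nd]]]]] :=
  IH (fun k => W (lift ord0 k)) (fun k => b (lift ord0 k)).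
have [N' [Ne' Ns' Nd']] := net_block_diag (esym Nd).
exists (q + m)%N, (row_mx (W ord0) V), (row_mx (b ord0) c), N'; split => //.
- move=> x k; have -> : affine (row_mx (W ord0) V) (row_mx (b ord0) c) x =
      row_mx (affine (W ord0) (b ord0) x) (affine V c x).
    by rewrite /affine mul_mx_row add_row_mx.
  rewrite relu_row_mx Ne'; case: (@split_ordP 1 p k) => j ->.
    rewrite (@row_mxEl _ 1 1 p); have -> : lshift p j = ord0 by apply: val_inj; rewrite ord1.
    by rewrite ord1.
  rewrite (@row_mxEr _ 1 1 p) Ne; have -> : rshift 1 j = lift ord0 j by exact: val_inj.
  by [].
- rewrite !nnz_row_mx mulSn addnACA leq_add// leq_add ?nnz_le//.
  by rewrite -[q in (_ <= q)%N]mul1n nnz_le.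
- by rewrite Ns' Ns mulSn.
Qed.

End net_parallel.

(** * A scalar network for the squared sine *)

Section sine_net.
Context (R : realType).
Implicit Types (t c w q : R) (r m : nat).

(* Hidden state of the scalar net: the three neurons [t], [relu (t - 1/2)] and
   the accumulator [c] holding partial sums of the series of [hump]. *)
Definition state t c : 'rV[R]_3 := \row_(i < 3) nth 0 [:: t; Num.max (t - 2^-1) 0; c] i.

Definition mx3 (s : seq (seq R)) : 'M[R]_3 := \matrix_(i, j) nth 0 (nth [::] s i) j.

Definition state_bias : 'rV[R]_3 := \row_(i < 3) nth 0 [:: 0; - 2^-1; 0] i.

(** States are row vectors: the first two columns form [tent t] out of the first two neurons, and
    the third adds [w * tent t] to the accumulator. *)
Definition tent_mx w := mx3 [:: [:: 2; 2; 2 * w]; [:: -4; -4; -4 * w]; [:: 0; 0; 1]].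

(** Starts a new round: [q] times the accumulator becomes the new argument and the accumulator is
    reset to 0. *)
Definition load_mx q := mx3 [:: [:: 0; 0; 0]; [:: 0; 0; 0]; [:: q; q; 0]].

(** The hypotheses make the first and third preactivations nonnegative, so ReLU only acts on the
    second neuron. *)
Lemma tent_layer w t c : 0 <= t <= 1 -> 0 <= c + w * tent t ->
  relu (affine (tent_mx w) state_bias (state t c)) = state (tent t) (c + w * tent t).
Proof.
move=> /tent_itv/andP[t0 _] c0; apply/rowP => j; rewrite /relu /affine !mxE.
rewrite !big_ord_recl big_ord0 !mxE /=.
case: j => [[|[|[|//]]] ?] /=.
- transitivity (Num.max (tent t) 0); last exact/max_idPl.
  by congr (Num.max _ _); rewrite /tent; ring.
- by congr (Num.max _ _); rewrite /tent; ring.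
- transitivity (Num.max (c + w * tent t) 0); last exact/max_idPl.
  by congr (Num.max _ _); rewrite /tent; ring.
Qed.

Lemma load_layer q t c : 0 <= q * c ->
  relu (affine (load_mx q) state_bias (state t c)) = state (q * c) 0.
Proof.
move=> c0; apply/rowP => j; rewrite /relu /affine !mxE.
rewrite !big_ord_recl big_ord0 !mxE /=.
case: j => [[|[|[|//]]] ?] /=.
- transitivity (Num.max (q * c) 0); last exact/max_idPl.
  by congr (Num.max _ _); ring.
- by congr (Num.max _ _); ring.
- transitivity (Num.max 0 0 : R); last exact: maxxx.
  by congr (Num.max _ _); ring.
Qed.

(** [N] is the continuation. The weight is divided by 4 at each layer, so the accumulator gains
    [w * takagi r t] in total. *)
Fixpoint takagi_net w r (N : relu_net R 3 1) : relu_net R 3 1 :=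
  if r is r'.+1 then HiddenLayer (tent_mx (w / 4)) state_bias (takagi_net (w / 4) r' N)
  else N.

(** For negative [w] the accumulator decreases but stays above [c + w * hump t], so ReLU never clips
    it. The final [t'] is not tracked, since a load layer reads only the accumulator. *)
Lemma takagi_netE w r N t c : 0 <= t <= 1 -> 0 <= c -> 0 <= c + w * hump t ->
  exists t', net_eval (takagi_net w r N) (state t c) =
             net_eval N (state t' (c + w * takagi r t)).
Proof.
elim: r w t c => [|r IH] w t c t01 c0 cw.
  by exists t; rewrite mulr0 addr0.
have t't := tent_itv t01; have /andP[h0 _] := hump_itv t't.
have hE : c + w * hump t = c + w / 4 * tent t + w / 4 * hump (tent t).
  by rewrite (hump_tent t); field.
have c1 : 0 <= c + w / 4 * tent t.
  (* If [w < 0], the terms still to come are nonpositive, so the partial sum is at least the full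
     sum, nonnegative by hypothesis. *)
  have /andP[t0 _] := t't; have [w0|w0] := leP 0 w.
    by rewrite addr_ge0// mulr_ge0// divr_ge0.
  rewrite (le_trans cw)// hE gerDl mulr_le0_ge0//; lra.
have [t' IHE] := IH (w / 4) (tent t) _ t't c1 (eq_ind _ (fun z => 0 <= z) cw _ hE).
exists t'; rewrite /= tent_layer// IHE.
by congr (net_eval N (state _ _)); field.
Qed.

Fixpoint logistic_net r m (N : relu_net R 3 1) : relu_net R 3 1 :=
  if m is m'.+1 then
    takagi_net 1 r (HiddenLayer (load_mx 4) state_bias (logistic_net r m' N))
  else N.

Lemma logistic_netE r m N t : 0 <= t <= 1 -> net_eval (logistic_net r m N) (state t 0) =
  net_eval N (state (iter m (fun v => 4 * takagi r v) t) 0).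
Proof.
elim: m t => [//|m IH] t t01; rewrite iterSr /=.
have h0 : 0 <= 0 + 1 * hump t by rewrite add0r mul1r; have /andP[] := hump_itv t01.
have [t' ->] := takagi_netE r
  (HiddenLayer (load_mx 4) state_bias (logistic_net r m N)) t01 (lexx 0) h0.
have t4 := takagi4_itv r t01; have /andP[t40 _] := t4.
by rewrite /= load_layer add0r mul1r// IH.
Qed.

(** Started with both argument and accumulator equal to x, weight -1 leaves x - takagi r x, close to
    x^2; then come [m] angle doublings and the output v -> A v + B. *)
Definition sine_net r m A B : relu_net R 3 1 :=
  takagi_net (-1) r (HiddenLayer (load_mx 1) state_bias
    (logistic_net r m (OutputLayer (\col_(i < 3) nth 0 [:: A; 0; 0] i) (const_mx B)))).

Lemma sine_netE r m A B x : 0 <= x <= 1 -> net_eval (sine_net r m A B) (state x x) 0 0 =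
  A * iter m (fun v => 4 * takagi r v) (x - takagi r x) + B.
Proof.
move=> x01; have /andP[x0 x1] := x01; rewrite /sine_net.
have xh : 0 <= x + -1 * hump x by rewrite /hump; have := sqr_ge0 x; lra.
set N := HiddenLayer _ _ _; have [t ->] := takagi_netE r N x01 x0 xh.
have /andP[h0 _] := takagi_hump r x01.
have y01 : 0 <= x - takagi r x <= 1.
  by have := takagi_ge0 r x01; move: h0; rewrite /hump; have := sqr_ge0 x; lra.
have yE : 1 * (x + -1 * takagi r x) = x - takagi r x by ring.
have /andP[y0 _] := y01.
rewrite /= load_layer yE// logistic_netE//= /affine !mxE.
by rewrite !big_ord_recl big_ord0 !mxE /=; ring.
Qed.

Lemma takagi_net_depth w r N : net_depth (takagi_net w r N) = (r + net_depth N)%N.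
Proof. by elim: r w => [//|r IH] w /=; rewrite IH. Qed.

Let layer_size (A : 'M[R]_3) (b : 'rV[R]_3) : (nnz A + nnz b <= 12)%N.
Proof. by rewrite (leq_trans (leq_add (nnz_le _) (nnz_le _))). Qed.

Lemma takagi_net_size w r N : (net_size (takagi_net w r N) <= 12 * r + net_size N)%N.
Proof.
elim: r w => [//|r IH] w /=.
by rewrite (leq_trans (leq_add (layer_size _ _) (IH _)))// mulnS addnA.
Qed.

Lemma sine_net_depth r m A B : net_depth (sine_net r m A B) = (m.+1 * r.+1)%N.
Proof.
rewrite takagi_net_depth /= mulSn addSnnS; congr (_ + _.+1)%N.
by elim: m => [//|m IH] /=; rewrite takagi_net_depth /= IH mulSn addSnnS.
Qed.

Lemma sine_net_size r m A B : (net_size (sine_net r m A B) <= 12 * (m.+1 * r.+1) + 4)%N.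
Proof.
have hl k N : (net_size (logistic_net r k N) <= 12 * (k * r.+1) + net_size N)%N.
  elim: k => [//|k IH] /=.
  rewrite (leq_trans (takagi_net_size _ _ _))//=.
  have := layer_size (load_mx 4) state_bias; move: IH; rewrite mulSn; lia.
rewrite (leq_trans (takagi_net_size _ _ _))//=.
set N := OutputLayer _ _; have := hl m N; have := layer_size (load_mx 1) state_bias.
have : (net_size N <= 4)%N by rewrite (leq_trans (leq_add (nnz_le _) (nnz_le _))).
rewrite mulSn; lia.
Qed.

End sine_net.

(** * The inner product of L2 *)

Section L2_inner.
Context d (T : measurableType d) (R : realType) (mu : {measure set T -> \bar R}).
Implicit Types u v w : L2 mu.

Lemma measurable_L2 u : measurable_fun setT (u : T -> R).
Proof. exact: (measurable_funPT (Lrepr u)). Qed.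

Lemma L2_Lfun u : (u : T -> R) \in Lfun mu 2%:E.
Proof. exact: (LfunP (Lrepr u)). Qed.

Lemma L2_mul_integrable u v : mu.-integrable setT (EFin \o (fun x => u x * v x)).
Proof. by apply/Lfun1_integrable/Lfun2_mul_Lfun1; exact: L2_Lfun. Qed.

Lemma L2D u v : ((u + v)%R : T -> R) = (fun x => u x + v x) %[ae mu].
Proof. exact: (LclassK (Lrepr u + Lrepr v)). Qed.

Lemma L2Z a u : ((a *: u)%R : T -> R) = (fun x => a * u x) %[ae mu].
Proof. exact: (LclassK (a *: Lrepr u)). Qed.

Lemma L2B u v : ((u - v)%R : T -> R) = (fun x => u x - v x) %[ae mu].
Proof.
rewrite -scaleN1r; have := L2Z (-1) v; have := L2D u (-1 *: v).
by apply: filterS2 => x /(_ I) -> /(_ I) -> _; rewrite mulN1r.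
Qed.

Lemma ae_eq_Rintegral (f g : T -> R) : measurable_fun setT f ->
  measurable_fun setT g -> f = g %[ae mu] ->
  \int[mu]_x f x = \int[mu]_x g x.
Proof.
move=> mf mg fg; congr fine; apply: ae_eq_integral => //.
- exact/measurable_EFinP.
- exact/measurable_EFinP.
- by move: fg; apply: filterS => x /= /[apply] ->.
Qed.

Lemma inner_ae u v (f g : T -> R) : measurable_fun setT f ->
  measurable_fun setT g -> (u : T -> R) = f %[ae mu] -> (v : T -> R) = g %[ae mu] ->
  inner u v = \int[mu]_x (f x * g x).
Proof.
move=> mf mg uf vg; apply: ae_eq_Rintegral.
- by apply: measurable_funM; exact: measurable_L2.
- exact: measurable_funM.
- by move: uf vg; apply: filterS2 => x /(_ I) -> /(_ I) ->.
Qed.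

Lemma innerC u v : inner u v = inner v u.
Proof. by apply: eq_Rintegral => x _; rewrite mulrC. Qed.

Lemma innerDl u v w : inner (u + v) w = inner u w + inner v w.
Proof.
rewrite (inner_ae _ (measurable_L2 w) (L2D u v))//; last first.
- exact: ae_eq_refl.
- by apply: measurable_funD; exact: measurable_L2.
rewrite -RintegralD//; last 2 first.
- exact: L2_mul_integrable.
- exact: L2_mul_integrable.
by apply: eq_Rintegral => x _; rewrite mulrDl.
Qed.

Lemma innerZl a u v : inner (a *: u) v = a * inner u v.
Proof.
rewrite (inner_ae _ (measurable_L2 v) (L2Z a u))//; last first.
- exact: ae_eq_refl.
- by apply: measurable_funM => //; exact: measurable_L2.
rewrite -RintegralZl//; last exact: L2_mul_integrable.
by apply: eq_Rintegral => x _; rewrite mulrA.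
Qed.

Lemma innerDr u v w : inner w (u + v) = inner w u + inner w v.
Proof. by rewrite innerC innerDl ![inner _ w]innerC. Qed.

Lemma innerZr a u v : inner u (a *: v) = a * inner u v.
Proof. by rewrite innerC innerZl innerC. Qed.

Lemma inner0l v : inner 0 v = 0.
Proof. by rewrite -(scale0r 0) innerZl mul0r. Qed.

Lemma innerNl u v : inner (- u) v = - inner u v.
Proof. by rewrite -scaleN1r innerZl mulN1r. Qed.

Lemma innerNr u v : inner v (- u) = - inner v u.
Proof. by rewrite innerC innerNl innerC. Qed.

Lemma innerBl u v w : inner (u - v) w = inner u w - inner v w.
Proof. by rewrite innerDl innerNl. Qed.

Lemma innerBr u v w : inner w (u - v) = inner w u - inner w v.
Proof. by rewrite innerDr innerNr. Qed.

Lemma inner_suml I (r : seq I) (P : pred I) (F : I -> L2 mu) v :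
  inner (\sum_(i <- r | P i) F i) v = \sum_(i <- r | P i) inner (F i) v.
Proof.
by elim/big_rec2: _ => [|i y x _ <-]; rewrite ?inner0l ?innerDl.
Qed.

Lemma inner_sumr I (r : seq I) (P : pred I) (F : I -> L2 mu) v :
  inner v (\sum_(i <- r | P i) F i) = \sum_(i <- r | P i) inner v (F i).
Proof. by rewrite innerC inner_suml; apply: eq_bigr => i _; rewrite innerC. Qed.

Lemma inner_norm u : inner u u = `|u| ^+ 2.
Proof.
rewrite Lspace_normE -powR_mulrn ?fine_ge0 ?Lnorm_ge0// -fine_poweR.
rewrite powR_Lnorm//; congr fine; apply: eq_integral => x _ /=.
by rewrite powR_mulrn// real_normK ?num_real// expr2.
Qed.

Lemma norm_sqr_sub u v : `|u - v| ^+ 2 = `|u| ^+ 2 - 2 * inner u v + `|v| ^+ 2.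
Proof.
rewrite -!inner_norm innerBl !innerBr (innerC v u); ring.
Qed.

Lemma norm_le_ae_bounded u (c : R) : 0 <= c -> (mu setT < +oo)%E ->
  {ae mu, forall x, `|u x| <= c} -> `|u| ^+ 2 <= c ^+ 2 * fine (mu setT).
Proof.
move=> c0 muoo uc; rewrite -inner_norm -lee_fin EFinM.
rewrite /inner /Rintegral fineK; last first.
  by apply: integrable_fin_num => //; exact: L2_mul_integrable.
rewrite fineK; last by rewrite ge0_fin_numE.
have mE : measurable_fun setT (fun x => (u x * u x)%:E).
  by apply/measurable_EFinP; apply: measurable_funM; exact: measurable_L2.
apply: le_trans (integral_le_bound (c ^+ 2)%:E measurableT mE _ _); last 2 first.
- by rewrite lee_fin sqr_ge0.
- move: uc; apply: filterS => x uxc _.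
  by rewrite lee_fin normrM -expr2 lerXn2r// nnegrE.
- rewrite le_eqVlt; apply/orP; left; apply/eqP; apply: eq_integral => x _.
  by rewrite [RHS]gee0_abs// lee_fin -expr2 sqr_ge0.
Qed.

(** Dominated convergence for the squared differences, whose integrals are the squared norms, then
    continuity of the square root. *)
Lemma L2_dominated (u_ : nat -> L2 mu) v (g : T -> R) :
  mu.-integrable setT (EFin \o g) ->
  {ae mu, forall x, (fun m => u_ m x) @ \oo --> (v x : R)} ->
  {ae mu, forall x m, (u_ m x - v x) ^+ 2 <= g x} ->
  (fun m => `|u_ m - v|) @ \oo --> 0.
Proof.
move=> ig uv ug.
have [] := @dominated_convergence _ _ _ mu setT measurableT
  (fun m x => ((u_ m x - v x) ^+ 2)%:E) (cst 0%E) (EFin \o g).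
- move=> m; apply/measurable_EFinP; apply: measurable_funX.
  by apply: measurable_funB; exact: measurable_L2.
- exact: measurable_cst.
- move: uv; apply: filterS => x uvx _.
  apply/cvg_EFin; first by near=> m.
  have h : (fun m => u_ m x - v x : R) @ \oo --> v x - v x.
    by apply: cvgB => //; exact: cvg_cst.
  by have := cvgM h h; rewrite subrr mul0r => /(_ _); exact.
- by [].
- move: ug; apply: filterS => x ugx m _.
  by rewrite lee_fin ger0_norm ?sqr_ge0.
move=> _ + _.
rewrite (_ : [sequence _]_n = (fun m => (`|u_ m - v| ^+ 2)%:E)); last first.
  apply/funext => m; rewrite -inner_norm.
  rewrite (inner_ae _ _ (L2B _ _) (L2B _ _)); last 2 first.
  - by apply: measurable_funB; exact: measurable_L2.
  - by apply: measurable_funB; exact: measurable_L2.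
  rewrite /Rintegral fineK; last first.
    apply: integrable_fin_num => //; apply/Lfun1_integrable.
    have f2 := LfunP (Lrepr (u_ m) - Lrepr v).
    exact: (Lfun2_mul_Lfun1 f2 f2).
  by apply: eq_integral => x _; rewrite sube0 gee0_abs ?lee_fin ?sqr_ge0// expr2.
move=> /fine_cvgP[_] h.
rewrite -(sqrtr0 R).
rewrite (_ : (fun _ => _) = (fun m => Num.sqrt (`|u_ m - v| ^+ 2))); last first.
  by apply/funext => m; rewrite sqrtr_sqr normr_id.
have := @continuous_cvg _ _ _ _ _ _ (@Num.sqrt R) _ (@sqrt_continuous R _) h. exact.
Unshelve. all: end_near.
Qed.

Lemma sqr_integrable_Lfun2 (f : T -> R) : measurable_fun setT f ->
  mu.-integrable setT (EFin \o (fun x => f x ^+ 2)) -> f \in Lfun mu 2%:E.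
Proof.
move=> mf /integrableP[_ f2oo].
rewrite inE; apply/andP; split; rewrite inE//=.
rewrite /finite_norm unlock /Lnorm; apply: poweR_lty.
apply: le_lt_trans f2oo; rewrite le_eqVlt; apply/orP; left; apply/eqP.
apply: eq_integral => x _ /=.
by rewrite powR_mulrn// -normrX.
Qed.

Lemma bounded_Lfun2 (f : T -> R) (C : R) : (mu setT < +oo)%E ->
  measurable_fun setT f -> {ae mu, forall x, `|f x| <= C} -> f \in Lfun mu 2%:E.
Proof.
move=> muoo mf fC; apply: sqr_integrable_Lfun2 => //.
have mf2 : measurable_fun setT (EFin \o (fun x => f x ^+ 2)).
  by apply/measurable_EFinP; exact: measurable_funX.
apply/integrableP; split => //.
apply: le_lt_trans (integral_le_bound (C ^+ 2)%:E measurableT mf2 _ _) _.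
- by rewrite lee_fin sqr_ge0.
- move: fC; apply: filterS => x xC _; rewrite lee_fin normrX lerXn2r ?nnegrE//.
  exact: le_trans xC.
- by rewrite lte_mul_pinfty// lee_fin sqr_ge0.
Qed.

Lemma L2_of_Lfun2 (f : T -> R) : f \in Lfun mu 2%:E ->
  exists u : L2 mu, (u : T -> R) = f %[ae mu].
Proof.
by move=> fL; exists (Lclass (Lfun_Sub (lee1n 2) fL)); exact: LclassK.
Qed.

End L2_inner.

(** * Perturbed orthonormal systems *)

Section l2norm.
Context (R : realType) (p : nat).
Implicit Types a : 'rV[R]_p.

Lemma l2norm_ge0 a : 0 <= l2norm a.
Proof. exact: sqrtr_ge0. Qed.

Lemma l2norm_sqr a : l2norm a ^+ 2 = \sum_(k < p) a 0 k ^+ 2.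
Proof. by rewrite sqr_sqrtr// sumr_ge0// => k _; exact: sqr_ge0. Qed.

Lemma ler_coord_l2norm a k : `|a 0 k| <= l2norm a.
Proof.
rewrite -sqrtr_sqr ler_sqrt; last by rewrite sumr_ge0// => i _; exact: sqr_ge0.
by rewrite (bigD1 k)//= lerDl sumr_ge0// => i _; exact: sqr_ge0.
Qed.

Lemma l2norm_eq0 a : l2norm a = 0 -> a = 0.
Proof.
move=> a0; apply/rowP => k; rewrite mxE; apply/eqP.
by rewrite -normr_le0 -a0; exact: ler_coord_l2norm.
Qed.

Lemma l2norm_gt0 a : a != 0 -> 0 < l2norm a.
Proof.
move=> a0; rewrite lt_def l2norm_ge0 andbT.
by apply: contra_neq a0; exact: l2norm_eq0.
Qed.

End l2norm.

Lemma Lip_le (R : realType) (U V : zmodType) (nU : U -> R) (nV : V -> R)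
    (f : U -> V) (c : R) : (forall x, x != 0 -> 0 < nU x) ->
  (forall x y, nV (f x - f y) <= c * nU (x - y)) -> (Lip nU nV f <= c%:E)%E.
Proof.
move=> nU0 fc; apply: ge_ereal_sup => _ [[x y] /= xy <-].
by rewrite lee_fin ler_pdivrMr// nU0// subr_eq0.
Qed.

Section near_orthonormal.
Context d (T : measurableType d) (R : realType) (mu : {measure set T -> \bar R}).
Context (p : nat) (e tau : 'I_p -> L2 mu) (delta : R).
Hypothesis e_orth : forall k l, inner (e k) (e l) = (k == l)%:R.
Hypothesis tau_e : forall k, `|tau k - e k| <= delta.
Hypothesis delta_le : p%:R * delta <= 2^-1.
Implicit Types (a b : 'rV[R]_p) (v : L2 mu).

Lemma reconstructionB (t : 'I_p -> L2 mu) a b :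
  reconstruction t (a - b) = reconstruction t a - reconstruction t b.
Proof.
rewrite /reconstruction -sumrB; apply: eq_bigr => k _.
by rewrite !mxE scalerBl.
Qed.

Lemma norm_reconstruction_orthonormal a : `|reconstruction e a| = l2norm a.
Proof.
apply/eqP; rewrite -(eqrXn2 (n := 2))// ?l2norm_ge0//; apply/eqP.
rewrite -inner_norm l2norm_sqr inner_suml; apply: eq_bigr => k _.
rewrite inner_sumr (bigD1 k)//= big1 => [|l lk]; last first.
  by rewrite innerZl innerZr e_orth eq_sym (negbTE lk) !mulr0.
by rewrite addr0 innerZl innerZr e_orth eqxx mulr1 expr2.
Qed.

(** Triangle inequality with each coordinate bounded by [l2norm a]; the resulting factor [p] is
    harmless because [delta] is taken small enough. *)
Lemma norm_reconstruction_sub a :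
  `|reconstruction tau a - reconstruction e a| <= p%:R * delta * l2norm a.
Proof.
rewrite /reconstruction -sumrB.
under eq_bigr do rewrite -scalerBr.
rewrite (le_trans (ler_norm_sum _ _ _))//.
have -> : p%:R * delta * l2norm a = \sum_(k < p) (delta * l2norm a).
  by rewrite sumr_const card_ord -mulrA mulr_natl.
apply: ler_sum => k _; rewrite normrZ mulrC ler_pM//.
exact: ler_coord_l2norm.
Qed.

Lemma norm_reconstruction_le a : `|reconstruction tau a| <= 2 * l2norm a.
Proof.
rewrite -(subrK (reconstruction e a) (reconstruction tau a)).
rewrite (le_trans (ler_normD _ _))// norm_reconstruction_orthonormal.
have := norm_reconstruction_sub a; have := l2norm_ge0 a.
have := ler_wpM2r (l2norm_ge0 a) delta_le; lra.
Qed.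

(** Synthesis by [e] is an isometry and [tau] perturbs it by at most 1/2, so a lower bound 1/2
    remains. Both independence and the Lipschitz bound of the projection rest on it. *)
Lemma l2norm_le_norm_reconstruction a : l2norm a <= 2 * `|reconstruction tau a|.
Proof.
rewrite -[leLHS]norm_reconstruction_orthonormal.
have := ler_distD (reconstruction tau a) (reconstruction e a) 0.
rewrite !subr0 distrC norm_reconstruction_orthonormal.
have := norm_reconstruction_sub a.
have := ler_wpM2r (l2norm_ge0 a) delta_le; lra.
Qed.

Lemma near_orthonormal_independent : linearly_independent tau.
Proof.
move=> a a0; apply: l2norm_eq0; apply/eqP; rewrite eq_le l2norm_ge0 andbT.
rewrite (le_trans (l2norm_le_norm_reconstruction a))//.
by rewrite /reconstruction a0 normr0 mulr0.
Qed.

Let gram : 'M[R]_p := \matrix_(k, l) inner (tau k) (tau l).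

(** A row in the kernel of the Gram matrix gives a combination of the [tau k] orthogonal to itself,
    hence zero. *)
Let gram_unit : gram \in unitmx.
Proof.
rewrite -row_free_unit -kermx_eq0; apply/rowV0P => a /sub_kermxP aG.
apply: near_orthonormal_independent; apply/normr0_eq0/eqP.
rewrite -sqrf_eq0 -inner_norm inner_sumr big1// => l _; rewrite innerZr.
suff -> : inner (\sum_(k < p) a 0 k *: tau k) (tau l) = 0 by rewrite mulr0.
have := congr1 (fun M : 'rV_p => M 0 l) aG; rewrite !mxE => <-.
by rewrite inner_suml; apply: eq_bigr => k _; rewrite innerZl mxE.
Qed.

Let taus (k : 'I_p) : L2 mu := \sum_(l < p) (invmx gram) k l *: tau l.

Let dual_taus : dual_basis tau taus.
Proof.
split=> [k|l k].
  by exists (row k (invmx gram)); apply: eq_bigr => l _; rewrite mxE.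
rewrite innerC inner_suml.
transitivity ((invmx gram *m gram) k l); last first.
  by rewrite mulVmx// mxE eq_sym.
by rewrite mxE; apply: eq_bigr => j _; rewrite innerZl mxE.
Qed.

Let tau_taus l : tau l = \sum_(k < p) gram l k *: taus k.
Proof.
transitivity (\sum_(j < p) (gram *m invmx gram) l j *: tau j).
  rewrite mulmxV// (bigD1 l)//= big1 => [|j jl]; last first.
    by rewrite mxE eq_sym (negbTE jl) scale0r.
  by rewrite mxE eqxx scale1r addr0.
under eq_bigr do rewrite mxE scaler_suml.
rewrite exchange_big/=; apply: eq_bigr => k _.
rewrite scaler_sumr; apply: eq_bigr => j _.
by rewrite scalerA.
Qed.

Let RP v := reconstruction tau (projection taus v).

(** After [tau l] is expanded in the dual basis, both inner products are the same sum of the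
    coordinates of [projection taus v] against row [l] of the Gram matrix. *)
Let RP_orth v l : inner (v - RP v) (tau l) = 0.
Proof.
rewrite innerBl inner_suml [in inner v _](tau_taus l) inner_sumr.
rewrite -sumrB big1// => k _.
by rewrite innerZr innerZl !mxE (innerC (tau l)) mulrC subrr.
Qed.

Let RP_pythagoras v a : `|v - reconstruction tau a| ^+ 2 =
  `|v - RP v| ^+ 2 + `|reconstruction tau (a - projection taus v)| ^+ 2.
Proof.
have -> : v - reconstruction tau a =
    (v - RP v) - reconstruction tau (a - projection taus v).
  by rewrite reconstructionB opprB addrA subrK.
rewrite norm_sqr_sub; set w := reconstruction _ (a - _).
have -> : inner (v - RP v) w = 0.
  by rewrite inner_sumr big1// => k _; rewrite innerZr RP_orth mulr0.
by rewrite mulr0 subr0.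
Qed.

(** R o P is an orthogonal projection, hence a best approximation. The bound for P follows from |P
    v| <= 2 |R (P v)| <= 2 |v|. *)
Lemma near_orthonormal_projection : exists taus : 'I_p -> L2 mu,
  let P := projection taus in
  [/\ dual_basis tau taus,
      forall v a, `|reconstruction tau (P v) - v| <= `|v - reconstruction tau a|,
      (Lip (@l2norm R p) (fun v => `|v|%R) (reconstruction tau) <= 2%:E)%E &
      (Lip (fun v => `|v|%R) (@l2norm R p) P <= 2%:E)%E].
Proof.
exists taus; split.
- exact: dual_taus.
- move=> v a; rewrite distrC -ler_sqr ?nnegrE//.
  by rewrite (RP_pythagoras v a) lerDl sqr_ge0.
- apply: Lip_le => [a|a b]; first exact: l2norm_gt0.
  by rewrite -reconstructionB; exact: norm_reconstruction_le.
- apply: Lip_le => [v|v w]; first by rewrite normr_gt0.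
  have -> : projection taus v - projection taus w = projection taus (v - w).
    by apply/rowP => k; rewrite !mxE innerBl.
  apply: le_trans (l2norm_le_norm_reconstruction _) _.
  rewrite ler_wpM2l// -ler_sqr ?nnegrE//.
  (* At a = 0 the Pythagorean identity bounds the norm of a projection by that of the vector. *)
  have := RP_pythagoras (v - w) 0; rewrite reconstructionB.
  have -> : reconstruction tau 0 = 0.
    by rewrite /reconstruction big1// => k _; rewrite mxE scale0r.
  by rewrite subr0 sub0r normrN => ->; rewrite lerDr sqr_ge0.
Qed.

End near_orthonormal.

(** * Expansions in a complete orthonormal system *)

Section orthonormal_basis.
Context d (T : measurableType d) (R : realType) (mu : {measure set T -> \bar R}).
Context (K : eqType) (e : K -> L2 mu).
Hypothesis e_orth : forall k l, inner (e k) (e l) = (k == l)%:R.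
Hypothesis e_dense : forall v (eps : R), 0 < eps ->
  exists r : seq (K * R), `|v - \sum_(z <- r) z.2 *: e z.1| < eps.

Let fsum (F : seq K) v := \sum_(k <- F) inner v (e k) *: e k.

Let fsum_orth F v k : uniq F -> k \in F -> inner (v - fsum F v) (e k) = 0.
Proof.
move=> uF kF; rewrite innerBl inner_suml (bigD1_seq k)//= big1 => [|l lk].
  by rewrite innerZl e_orth eqxx mulr1 addr0 subrr.
by rewrite innerZl e_orth (negbTE lk) mulr0.
Qed.

(** The residual is orthogonal to every [e k] with k in [F], so any other combination adds an
    orthogonal error. *)
Let fsum_best F v (r : seq (K * R)) : uniq F -> {subset [seq z.1 | z <- r] <= F} ->
  `|v - fsum F v| <= `|v - \sum_(z <- r) z.2 *: e z.1|.
Proof.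
move=> uF rF; set u := \sum_(z <- r) _.
rewrite -ler_sqr ?nnegrE//.
have -> : v - u = (v - fsum F v) - (u - fsum F v) by rewrite opprB addrA subrK.
rewrite (norm_sqr_sub (v - fsum F v)). 
have -> : inner (v - fsum F v) (u - fsum F v) = 0.
  rewrite innerBr !inner_sumr big_seq big1 => [|z zr]; last first.
    by rewrite innerZr fsum_orth ?mulr0// rF// map_f.
  rewrite big_seq big1 ?subr0// => k kF.
  by rewrite innerZr fsum_orth ?mulr0.
by rewrite mulr0 subr0 lerDl sqr_ge0.
Qed.

Let fsum_norm F v : uniq F ->
  `|v - fsum F v| ^+ 2 = `|v| ^+ 2 - \sum_(k <- F) inner v (e k) ^+ 2.
Proof.
move=> uF; rewrite -inner_norm innerBr.
rewrite [X in _ - X]inner_sumr [X in _ - X]big_seq [X in _ - X]big1 => [|k kF].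
  rewrite subr0 innerBl inner_norm inner_suml; congr (_ - _).
  by apply: eq_bigr => k _; rewrite innerZl innerC expr2.
by rewrite innerZr fsum_orth ?mulr0.
Qed.

(** A form of Parseval's identity using finite sums only: adjoining to [F] the finitely many indices
    of a good approximation leaves a residual below eps, and the adjoined coefficients contribute at
    most [B]. *)
Lemma orthonormal_basis_tail F v (B : R) : uniq F ->
  (forall G, uniq G -> {in G, forall k, k \notin F} ->
    \sum_(k <- G) inner v (e k) ^+ 2 <= B) ->
  `|v - \sum_(k <- F) inner v (e k) *: e k| ^+ 2 <= B.
Proof.
move=> uF FB; apply/ler_addgt0Pl => eps eps0.
have /(e_dense v)[r vr] : 0 < Num.sqrt eps by rewrite sqrtr_gt0.
pose G := [seq k <- undup [seq z.1 | z <- r] | k \notin F].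
have uG : uniq G by rewrite filter_uniq// undup_uniq.
have GF : {in G, forall k, k \notin F} by move=> k; rewrite mem_filter => /andP[].
have uFG : uniq (F ++ G).
  rewrite cat_uniq uF uG andbT/=; apply/hasPn => k /GF /negbTE; exact: negbT.
have rFG : {subset [seq z.1 | z <- r] <= F ++ G}.
  move=> k kr; rewrite mem_cat mem_filter mem_undup kr andbT; exact: orbN.
have := fsum_best v uFG rFG => /le_lt_trans/(_ vr) h.
have {}h : `|v - fsum (F ++ G) v| ^+ 2 <= eps.
  by rewrite -(sqr_sqrtr (ltW eps0)) ler_sqr ?nnegrE ?sqrtr_ge0// ltW.
have := FB G uG GF; move: h.
have := fsum_norm v uF; rewrite /fsum => ->.
rewrite (fsum_norm v uFG) big_cat/=; lra.
Qed.

End orthonormal_basis.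

(** * The Hartley basis *)

Section torus_measure_facts.
Context (R : realType) (n : nat).
Local Notation T := 'rV[R]_n.

Lemma torus_measure_setT : torus_measure R n setT = ((2 * pi) ^+ n)%:E.
Proof.
rewrite /torus_measure /mrestr setTI /torus.
by rewrite lebesgue_rV_cube ?subr0// mulr_ge0// pi_ge0.
Qed.

Lemma torus_measure_finite : (torus_measure R n setT < +oo)%E.
Proof. by rewrite torus_measure_setT ltry. Qed.

Lemma ae_torus : {ae torus_measure R n, forall x, torus R n x}.
Proof.
exists (~` torus R n); split => //; first by apply: measurableC; exact: measurable_torus.
by rewrite /torus_measure /mrestr setICl (measure0 (lebesgue_rV R n)).
Qed.

Lemma torus_integralE (f : T -> \bar R) : measurable_fun setT f ->
  (\int[torus_measure R n]_x f x = \int[lebesgue_rV R n]_(x in torus R n) f x)%E.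
Proof.
move=> mf.
transitivity (\int[torus_measure R n]_(x in torus R n) f x)%E.
  rewrite [RHS]integral_mkcond; apply: ae_eq_integral => //.
    by apply/(measurable_restrictT f (@measurable_torus R n)); exact: measurable_funTS.
  move: ae_torus; apply: filterS => x xT _.
  by rewrite patchE mem_set.
apply: eq_measure_integral => A mA AT.
by rewrite /= /torus_measure /mrestr setIidl.
Qed.

Lemma bounded_integrable_torus (f : T -> R) (C : R) : measurable_fun setT f ->
  (forall x, `|f x| <= C) -> (torus_measure R n).-integrable setT (EFin \o f).
Proof.
move=> mf fC; have mEf : measurable_fun setT (EFin \o f) by apply/measurable_EFinP.
apply/integrableP; split => //.
have C0 : 0 <= C by rewrite (le_trans _ (fC 0)).
apply: le_lt_trans (integral_le_bound C%:E measurableT mEf _ _) _.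
- by rewrite lee_fin.
- by apply: aeW => x _; rewrite lee_fin.
- by rewrite lte_mul_pinfty ?torus_measure_finite// lee_fin.
Qed.

Lemma measurable_phase (k : 'rV[int]_n) : measurable_fun setT (@phase R n k).
Proof.
rewrite /phase; apply: measurable_sum => i.
apply: measurable_funM => //; exact: measurable_rV_coord.
Qed.

Lemma phaseD (k l : 'rV[int]_n) (x : T) : phase (k + l) x = phase k x + phase l x.
Proof.
rewrite /phase -big_split/=; apply: eq_bigr => i _.
by rewrite mxE intrD mulrDl.
Qed.

Lemma phaseN (k : 'rV[int]_n) (x : T) : phase (- k) x = - phase k x.
Proof.
rewrite /phase -sumrN; apply: eq_bigr => i _.
by rewrite mxE intrN mulNr.
Qed.

Lemma phaseB (k l : 'rV[int]_n) (x : T) : phase (k - l) x = phase k x - phase l x.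
Proof. by rewrite phaseD phaseN. Qed.

End torus_measure_facts.

Lemma phase_cons (R : realType) (n : nat) (k : 'rV[int]_(1 + n)) (t : R) (x : 'rV[R]_n) :
  phase k (cons_rV (t, x)) = (k 0 0)%:~R * t + phase (rsubmx k) x.
Proof.
rewrite /phase big_ord_recl; congr (_ + _).
  congr (_ * _).
  transitivity (cons_rV (t, x) 0 (lshift n 0)).
    by congr (cons_rV _ _ _); exact: val_inj.
  by rewrite /cons_rV row_mxEl mxE.
apply: eq_bigr => i _; rewrite [in RHS]mxE.
have -> : lift ord0 i = rshift 1 i by exact: val_inj.
by rewrite /cons_rV row_mxEr.
Qed.

Lemma periodic_int (R : realType) (f : R -> R) (a : int) (x : R) :
  periodic f (pi *+ 2) -> f (a%:~R * (2 * pi) + x) = f x.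
Proof.
move=> pf; rewrite mulr_natl addrC; case: a => m.
  by rewrite -pmulrn mulr_natl periodicn.
by rewrite NegzE mulrNz mulNr -pmulrn mulr_natl -(periodicn pf m.+1 (_ - _)) subrK.
Qed.

(** The antiderivative sin(a t + phi) / a agrees at both ends because [a] is a nonzero integer. *)
Lemma integral_cos_period (R : realType) (a : int) (phi : R) : a != 0 ->
  (\int[@lebesgue_measure R]_(t in `[0%R, (2 * pi)%R]) (cos (a%:~R * t + phi))%:E = 0)%E.
Proof.
move=> a0; have a0R : a%:~R != 0 :> R by rewrite intr_eq0.
pose F (t : R) := a%:~R^-1 * sin (a%:~R * t + phi).
have dF (t : R) : is_derive t 1 F (cos (a%:~R * t + phi)).
  rewrite /F; apply: is_derive_eq.
  by rewrite addr0 /GRing.scale/= mulr1 mulrC -mulrA mulfV// mulr1.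
have cF : continuous F.
  move=> t; apply/differentiable_continuous/derivable1_diffP.
  exact: (@ex_derive _ _ _ _ _ _ _ (dF t)).
rewrite (@continuous_FTC2 _ (fun t => cos (a%:~R * t + phi)) F).
- by rewrite /F mulr0 add0r periodic_int ?subee//; exact: sinD2pi.
- by rewrite mulr_gt0// pi_gt0.
- apply: continuous_subspaceT => t; apply: continuous_comp; last exact: continuous_cos.
  by apply: cvgD; [apply: cvgM; [exact: cvg_cst|exact: cvg_id]|exact: cvg_cst].
- split.
  + by move=> x _; exact: (@ex_derive _ _ _ _ _ _ _ (dF x)).
  + by apply: cvg_at_right_filter; exact: cF.
  + by apply: cvg_at_left_filter; exact: cF.
- by move=> x _; rewrite derive1E; exact: (@derive_val _ _ _ _ _ _ _ (dF x)).
Qed.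

(** * Fubini's theorem on the torus *)

Section torus_fubini.
Context (R : realType) (n : nat) (f : 'rV[R]_(1 + n) -> R) (C : R).
Hypothesis mf : measurable_fun setT f.
Hypothesis fC : forall x, `|f x| <= C.
Local Notation I := [set` `[0%R, (2 * pi : R)%R]].
Local Notation leb := (@lebesgue_measure R).

(** Extended by zero, so that Fubini applies on the whole product space. *)
Let g : 'rV[R]_(1 + n) -> \bar R := (EFin \o f) \_ (torus R (1 + n)).

Let torus_cons t y : torus R (1 + n) (cons_rV (t, y)) <-> I t /\ torus R n y.
Proof.
split=> [h|[It Ty] i].
  split=> [|i].
    have := h (lshift n 0); rewrite (@row_mxEl _ 1 1 n) mxE/=.
    by rewrite in_itv.
  by have := h (rshift 1 i); rewrite (@row_mxEr _ 1 1 n).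
case: (@split_ordP 1 n i) => j ->.
  by rewrite (@row_mxEl _ 1 1 n) mxE; move: It; rewrite /= in_itv.
by rewrite (@row_mxEr _ 1 1 n).
Qed.

Let g_cons t y : g (cons_rV (t, y)) =
  if (t \in I) && (y \in torus R n) then (f (cons_rV (t, y)))%:E else 0%E.
Proof.
rewrite /g patchE; case: ifPn => [/set_mem/torus_cons[It Ty]|/negP h].
  by rewrite !mem_set.
by case: ifPn => // /andP[/set_mem It /set_mem Ty]; case: h; apply/mem_set/torus_cons.
Qed.

Let integrable_g : (lebesgue_rV R (1 + n)).-integrable setT g.
Proof.
apply/(integrable_mkcond _ (@measurable_torus R (1 + n))).
have /integrableP[mEf foo] := bounded_integrable_torus mf fC.
apply/integrableP; split; first exact: measurable_funTS.
rewrite -torus_integralE//.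
exact: measurableT_comp.
Qed.

Let mcons : measurable_fun setT (@cons_rV R n).
Proof. exact: measurable_cons_rV. Qed.

Let integrable_g_cons :
  (leb \x lebesgue_rV R n)%E.-integrable setT (g \o @cons_rV R n).
Proof.
have /integrableP[mg goo] := integrable_g.
apply/integrableP; split; first exact: measurableT_comp.
move: goo; rewrite [X in (X < _)%E -> _](_ : _ =
  (\int[pushforward (leb \x lebesgue_rV R n)%E (@cons_rV R n)]_x `|g x|)%E)//.
rewrite ge0_integral_pushforward//.
by apply: measurableT_comp.
Qed.

Let torus_integral_prod : (\int[torus_measure R (1 + n)]_x (f x)%:E =
  \int[leb \x lebesgue_rV R n]_z (g \o @cons_rV R n) z)%E.
Proof.
have mEf : measurable_fun setT (EFin \o f) by apply/measurable_EFinP.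
rewrite torus_integralE// integral_mkcond.
transitivity (\int[pushforward (leb \x lebesgue_rV R n)%E (@cons_rV R n)]_x g x)%E => //.
rewrite integral_pushforward//.
by have /integrableP[] := integrable_g.
Qed.

Lemma torus_integral_cons12 : (\int[torus_measure R (1 + n)]_x (f x)%:E =
  \int[leb]_(t in I) \int[torus_measure R n]_y (f (cons_rV (t, y)))%:E)%E.
Proof.
rewrite torus_integral_prod -integral12_prod_meas1//= [RHS]integral_mkcond.
apply: eq_integral => t _; rewrite /fubini_F patchE.
under eq_integral do rewrite /= g_cons.
case: ifPn => tI /=; last by rewrite integral0.
rewrite torus_integralE; last first.
  apply/measurable_EFinP; apply: (measurableT_comp mf).
  by apply: (measurableT_comp mcons); exact: measurable_pair1.
by rewrite [RHS]integral_mkcond; apply: eq_integral => y _; rewrite patchE.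
Qed.

(** Fubini with the first coordinate innermost, for frequencies whose first component is nonzero;
    [torus_integral_cons12] serves the others. *)
Lemma torus_integral_cons_eq0 :
  (forall y, \int[leb]_(t in I) (f (cons_rV (t, y)))%:E = 0)%E ->
  (\int[torus_measure R (1 + n)]_x (f x)%:E = 0)%E.
Proof.
move=> f0; rewrite torus_integral_prod -integral21_prod_meas1//=.
rewrite integral0_eq// => y _; rewrite /fubini_G.
under eq_integral do rewrite /= g_cons.
have [yT|yT] := boolP (y \in torus R n); last first.
  by rewrite integral0_eq// => t _; rewrite andbF.
rewrite -[RHS](f0 y) [RHS]integral_mkcond; apply: eq_integral => t _.
by rewrite andbT patchE.
Qed.

End torus_fubini.

Lemma measurable_cos_phase (R : realType) n (k : 'rV[int]_n) (phi : R) :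
  measurable_fun setT (fun x : 'rV[R]_n => cos (phase k x + phi)).
Proof.
apply: (measurableT_comp (continuous_measurable_fun (@continuous_cos R))).
by apply: measurable_funD => //; exact: measurable_phase.
Qed.

(** Induction on the dimension. If the first component of [k] is nonzero, integrating over that
    coordinate gives 0; otherwise the rest of [k] is nonzero. The free [phi] absorbs the phase of
    the other coordinates. *)
Lemma torus_integral_cos (R : realType) n (k : 'rV[int]_n) (phi : R) : k != 0 ->
  (\int[torus_measure R n]_x (cos (phase k x + phi))%:E = 0)%E.
Proof.
have cos1 m (l : 'rV[int]_m) psi (x : 'rV[R]_m) : `|cos (phase l x + psi)| <= 1.
  by rewrite ler_norml cos_geN1 cos_le1.
elim: n k phi => [|n IH] k phi k0.
  by case/eqP: k0; apply/rowP; case.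
have [k00|k00] := eqVneq (k 0 0) 0; last first.
  apply: (torus_integral_cons_eq0 (measurable_cos_phase k phi) (cos1 _ k phi)) => y.
  under eq_integral do rewrite phase_cons -addrA.
  exact: integral_cos_period.
rewrite (torus_integral_cons12 (measurable_cos_phase k phi) (cos1 _ k phi)).
rewrite integral0_eq// => t _.
under eq_integral do rewrite phase_cons k00 mul0r add0r.
apply: IH; apply: contra_neq k0 => k'0.
apply/rowP => i; case: (@split_ordP 1 n i) => j ->; rewrite mxE.
  by rewrite -[RHS]k00; congr (k _ _); apply: val_inj; rewrite ord1.
by have := congr1 (fun v : 'rV_n => v 0 j) k'0; rewrite !mxE.
Qed.

(** One factor of the product is null: a point of the line or, by induction, a hyperplane in the
    other coordinates. *)
Lemma lebesgue_rV_hyperplane (R : realType) n (i : 'I_n) (a : R) :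
  lebesgue_rV R n [set x | x 0 i = a] = 0%E.
Proof.
elim: n i => [|n IH] i /=; first by case: i.
rewrite /lebesgue_cons /pushforward.
case: (@split_ordP 1 n i) => j ->.
  rewrite (_ : _ @^-1` _ = [set a] `*` setT).
    rewrite product_measure1E; [|exact: measurable_set1|exact: measurableT].
    by rewrite [X in (X * _)%E]lebesgue_measure_set1 mul0e.
  apply/seteqP; split => -[t x] /=; rewrite /cons_rV /= (@row_mxEl _ 1 1 n) mxE//.
  by case.
transitivity ((@lebesgue_measure R \x lebesgue_rV R n)%E
    (setT `*` [set x : 'rV[R]_n | x 0 j = a])).
  congr (_ _); apply/seteqP; split => -[t x] /=.
    by rewrite /cons_rV /= (@row_mxEr _ 1 1 n).
  by rewrite /cons_rV /= (@row_mxEr _ 1 1 n) => -[].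
rewrite product_measure1E//; first by rewrite (IH j) mule0.
rewrite -[X in measurable X]setTI.
exact: (@measurable_rV_coord R n j measurableT [set a] (measurable_set1 a)).
Qed.

Lemma ae_torus_hyperplane (R : realType) n (i : 'I_n) (a : R) :
  {ae torus_measure R n, forall x : 'rV[R]_n, x 0 i != a}.
Proof.
have mH : measurable [set x : 'rV[R]_n | x 0 i = a].
  rewrite -[X in measurable X]setTI.
  exact: (@measurable_rV_coord R n i measurableT [set a] (measurable_set1 a)).
exists [set x : 'rV[R]_n | x 0 i = a]; split; first exact: mH.
- apply: (subset_measure0 _ _ (@subIsetl _ _ _) (lebesgue_rV_hyperplane i a)).
  + by apply: measurableI; [exact: mH|exact: measurable_torus].
  + exact: mH.
- by move=> x /= /negP; rewrite negbK => /eqP.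
Qed.
Section hartley_basis.
Context (R : realType) (n : nat).
Local Notation W := ((2 * pi) ^+ n : R).
Implicit Types k l : 'rV[int]_n.

Lemma torus_volume_gt0 : 0 < W.
Proof. by rewrite exprn_gt0// mulr_gt0// pi_gt0. Qed.

Definition cas (x : R) : R := cos x + sin x.

(** sin(pi / 4) and cos(pi / 4) coincide and their squares sum to 1, so both equal 1 / sqrt 2. A
    basis function thus becomes a single shifted cosine. *)
Lemma casE x : cas x = Num.sqrt 2 * cos (x - pi / 4).
Proof.
have c0 : 0 < cos (pi / 4 : R).
  by apply: cos_gt0_pihalf; have := pi_gt0 R; lra.
have sc : sin (pi / 4 : R) = cos (pi / 4).
  have := tan_piquarter R; rewrite /tan => /(congr1 ( *%R ^~ (cos (pi / 4)))).
  by rewrite mulfVK ?gt_eqF// mul1r.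
have c2 : Num.sqrt 2 * cos (pi / 4 : R) = 1.
  apply/eqP; rewrite -sqrp_eq1; last by rewrite mulr_ge0 ?sqrtr_ge0 ?ltW.
  rewrite exprMn sqr_sqrtr//; have := cos2Dsin2 (pi / 4 : R).
  by rewrite sc => h; apply/eqP; lra.
by rewrite cosB sc -mulrDl mulrCA c2 mulr1.
Qed.

Lemma cas_mul x y : cas x * cas y = cos (x - y) + sin (x + y).
Proof. by rewrite /cas cosB sinD; ring. Qed.

Lemma cas_bound x : `|cas x| <= 2.
Proof.
rewrite (le_trans (ler_normD _ _))// -[2]/(1 + 1) lerD//.
  exact: cos_max.
exact: sin_max.
Qed.

Lemma sin_cos_shift (x : R) : sin x = cos (x - pi / 2).
Proof. by rewrite cosB cos_pihalf sin_pihalf mulr0 add0r mulr1. Qed.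

Lemma measurable_sin_phase k : measurable_fun setT (fun x : 'rV[R]_n => sin (phase k x)).
Proof.
rewrite (_ : (fun _ => _) = (fun x => cos (phase k x + (- (pi / 2))))).
  exact: measurable_cos_phase.
by apply/funext => x; rewrite sin_cos_shift.
Qed.

Lemma measurable_cos_phase0 k : measurable_fun setT (fun x : 'rV[R]_n => cos (phase k x)).
Proof.
rewrite (_ : (fun _ => _) = (fun x => cos (phase k x + 0))).
  exact: measurable_cos_phase.
by apply/funext => x; rewrite addr0.
Qed.

Lemma measurable_cas k : measurable_fun setT (fun x : 'rV[R]_n => cas (phase k x)).
Proof.
by apply: measurable_funD; [exact: measurable_cos_phase0|exact: measurable_sin_phase].
Qed.

Lemma phase0 (x : 'rV[R]_n) : phase (0 : 'rV[int]_n) x = 0.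
Proof. by rewrite /phase big1// => i _; rewrite mxE mul0r. Qed.

Lemma torus_Rintegral_cos k :
  \int[torus_measure R n]_x cos (phase k x) = W * (k == 0)%:R.
Proof.
have [->|k0] := eqVneq k 0.
  under eq_Rintegral do rewrite phase0 cos0.
  rewrite Rintegral_cst// ?torus_measure_finite//.
  by rewrite mul1r mulr1; exact: (congr1 fine (@torus_measure_setT R n)).
rewrite mulr0 /Rintegral.
under eq_integral do rewrite -[phase _ _]addr0.
by rewrite torus_integral_cos.
Qed.

Lemma torus_Rintegral_sin k : \int[torus_measure R n]_x sin (phase k x) = 0.
Proof.
have [->|k0] := eqVneq k 0.
  under eq_Rintegral do rewrite phase0 sin0.
  by rewrite /Rintegral integral0.
rewrite /Rintegral.
under eq_integral do rewrite sin_cos_shift.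
by rewrite torus_integral_cos.
Qed.

Lemma hartley_subproof k : exists u : L2 (torus_measure R n),
  (u : 'rV[R]_n -> R) = (fun x => (Num.sqrt W)^-1 * cas (phase k x)) %[ae torus_measure R n].
Proof.
apply/L2_of_Lfun2/(@bounded_Lfun2 _ _ _ _ _ ((Num.sqrt W)^-1 * 2)).
- exact: torus_measure_finite.
- by apply: measurable_funM => //; exact: measurable_cas.
- apply: aeW => x; rewrite normrM ger0_norm ?invr_ge0 ?sqrtr_ge0//.
  by rewrite ler_wpM2l ?invr_ge0 ?sqrtr_ge0// cas_bound.
Qed.

Definition hartley k : L2 (torus_measure R n) := sval (cid (hartley_subproof k)).

Lemma hartleyE k : (hartley k : 'rV[R]_n -> R) =
  (fun x => (Num.sqrt W)^-1 * cas (phase k x)) %[ae torus_measure R n].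
Proof. exact: (svalP (cid (hartley_subproof k))). Qed.

Let sqrtW : (Num.sqrt W)^-1 * (Num.sqrt W)^-1 = W^-1.
Proof. by rewrite -invfM -expr2 sqr_sqrtr// ltW// torus_volume_gt0. Qed.

Let mhartley k : measurable_fun setT
  (fun x : 'rV[R]_n => (Num.sqrt W)^-1 * cas (phase k x)).
Proof. by apply: measurable_funM => //; exact: measurable_cas. Qed.

(** By [cas_mul] the product is the cosine of frequency k - l plus the sine of frequency k + l; only
    the cosine of frequency 0 has a nonzero integral. *)
Lemma hartley_orthonormal k l : inner (hartley k) (hartley l) = (k == l)%:R.
Proof.
rewrite (inner_ae (mhartley k) (mhartley l) (hartleyE k) (hartleyE l)).
have icos m : (torus_measure R n).-integrable setT (EFin \o (fun x => cos (phase m x))).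
  apply: (bounded_integrable_torus (C := 1)); first exact: measurable_cos_phase0.
  by move=> x; exact: cos_max.
have isin m : (torus_measure R n).-integrable setT (EFin \o (fun x => sin (phase m x))).
  apply: (bounded_integrable_torus (C := 1)); first exact: measurable_sin_phase.
  by move=> x; exact: sin_max.
transitivity (\int[torus_measure R n]_x
    (W^-1 * (cos (phase (k - l) x) + sin (phase (k + l) x)))).
  by apply: eq_Rintegral => x _; rewrite mulrACA sqrtW cas_mul phaseB phaseD.
rewrite RintegralZl//; last exact: (integrableD _ (icos _) (isin _)).
rewrite RintegralD// torus_Rintegral_cos torus_Rintegral_sin addr0 mulKf.
  by rewrite subr_eq0.
by rewrite gt_eqF// torus_volume_gt0.
Qed.

(** With A and B the cosine and sine integrals of v, the left side is (A + B)^2 / W and the right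
    side 2 (A^2 + B^2) / W. *)
Lemma inner_hartley_le (v : L2 (torus_measure R n)) k :
  inner v (hartley k) ^+ 2 <= 2 * W * Normc.normc (fourier_coef v k) ^+ 2.
Proof.
have aux (w a b : R) : w != 0 ->
    2 * w * ((w^-1 * a) ^+ 2 + (- (w^-1 * b)) ^+ 2) = w^-1 * (2 * (a ^+ 2 + b ^+ 2)).
  by move=> w0; field.
rewrite (inner_ae (measurable_L2 v) (mhartley k) (ae_eq_refl _ _ _) (hartleyE k)).
set A := \int[torus_measure R n]_x (v x * cos (phase k x)).
set B := \int[torus_measure R n]_x (v x * sin (phase k x)).
have iv (f : 'rV[R]_n -> R) : measurable_fun setT f -> (forall x, `|f x| <= 1) ->
    (torus_measure R n).-integrable setT (EFin \o (fun x => v x * f x)).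
  move=> mf f1; apply/Lfun1_integrable/Lfun2_mul_Lfun1; first exact: L2_Lfun.
  apply: (@bounded_Lfun2 _ _ _ _ _ 1) => //; first exact: torus_measure_finite.
  exact: aeW.
have ivc := iv _ (measurable_cos_phase0 k) (fun x => cos_max (phase k x)).
have ivs := iv _ (measurable_sin_phase k) (fun x => sin_max (phase k x)).
have -> : \int[torus_measure R n]_x (v x * ((Num.sqrt W)^-1 * cas (phase k x))) =
    (Num.sqrt W)^-1 * (A + B).
  rewrite /A /B -RintegralD// -RintegralZl//; last exact: (integrableD _ ivc ivs).
  by apply: eq_Rintegral => x _; rewrite -mulrDr mulrCA.
rewrite /= -/A -/B sqr_sqrtr ?addr_ge0 ?sqr_ge0//.
have -> : ((Num.sqrt W)^-1 * (A + B)) ^+ 2 = W^-1 * (A + B) ^+ 2.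
  by rewrite exprMn -sqrtW.
have W0 := torus_volume_gt0.
rewrite aux ?gt_eqF// ler_wpM2l//; first by rewrite invr_ge0 ltW.
clearbody A B; have := sqr_ge0 (A - B); lra.
Qed.

End hartley_basis.

(** * Completeness of the Hartley basis *)

Section step_approximation.
Context (R : realType).
Implicit Types (t a x b : R) (m k : nat).

Lemma bernoulli_sub a k : 0 <= a <= 1 -> 1 - k%:R * a <= (1 - a) ^+ k.
Proof.
move=> /andP[a0 a1]; elim: k => [|k IH]; first by rewrite mul0r subr0 expr0.
rewrite exprS; apply: le_trans (ler_wpM2l _ IH); last by rewrite subr_ge0.
have : 0 <= k%:R * a * a by rewrite !mulr_ge0.
by rewrite -natr1; lra.
Qed.

Lemma bernoulli_add a k : 0 <= a -> 1 + k%:R * a <= (1 + a) ^+ k.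
Proof.
move=> a0; elim: k => [|k IH]; first by rewrite mul0r addr0 expr0.
rewrite exprS; apply: le_trans (ler_wpM2l _ IH); last by rewrite addr_ge0.
have : 0 <= k%:R * a * a by rewrite !mulr_ge0.
by rewrite -natr1; lra.
Qed.

(** Bernoulli bounds k a by (1 + a)^k, and (1 + a)^k (1 - a)^k = (1 - a^2)^k <= 1. *)
Lemma bernoulli_mul a k : 0 <= a <= 1 -> k%:R * a * (1 - a) ^+ k <= 1.
Proof.
move=> /andP[a0 a1]; apply: (@le_trans _ _ ((1 + a) ^+ k * (1 - a) ^+ k)).
  rewrite ler_wpM2r ?exprn_ge0 ?subr_ge0//.
  by rewrite (le_trans _ (bernoulli_add k a0))// lerDr.
rewrite -exprMn exprn_ile1//.
  by rewrite mulr_ge0 //; lra.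
by have := sqr_ge0 a; rewrite expr2; lra.
Qed.

(* Since [t ^ m * 2 ^ m = (2 t) ^ m], this tends to a step at [t = 1/2]. *)
Definition peak m t : R := (1 - t ^+ m) ^+ (2 ^ m).

Lemma peak_itv m t : 0 <= t <= 1 -> 0 <= peak m t <= 1.
Proof.
move=> /andP[t0 t1]; have tm : 0 <= t ^+ m <= 1 by rewrite exprn_ge0//= exprn_ile1.
rewrite /peak exprn_ge0 ?subr_ge0 ?(andP tm).2//=.
by rewrite exprn_ile1 ?subr_ge0 ?(andP tm).2// lerBlDr lerDl (andP tm).1.
Qed.

(** Squeezed between 1 - (2 t)^m, from [bernoulli_sub], and 1. *)
Lemma cvg_peak1 t : 0 <= t < 2^-1 -> (fun m => peak m t) @ \oo --> (1 : R).
Proof.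
move=> /andP[t0 t1].
apply: (@squeeze_cvgr _ _ _ _ (fun m => 1 - (2 * t) ^+ m) (fun=> 1)).
- near=> m.
  have tm : 0 <= t ^+ m <= 1 by rewrite exprn_ge0//= exprn_ile1//; lra.
  rewrite (andP (peak_itv m _)).2 ?andbT; last by rewrite t0; lra.
  by have := bernoulli_sub (2 ^ m) tm; rewrite natrX -exprMn.
- rewrite -[X in _ --> X]subr0; apply: cvgB; first exact: cvg_cst.
  by apply: cvg_expr; rewrite ger0_norm ?mulr_ge0//; lra.
- exact: cvg_cst.
Unshelve. all: end_near. Qed.

(** Squeezed between 0 and (2 t)^(-m), from [bernoulli_mul]. *)
Lemma cvg_peak0 t : 2^-1 < t <= 1 -> (fun m => peak m t) @ \oo --> (0 : R).
Proof.
move=> /andP[t0 t1].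
apply: (@squeeze_cvgr _ _ _ _ (fun=> 0) (fun m => ((2 * t)^-1) ^+ m)).
- near=> m.
  have tm : 0 <= t ^+ m <= 1 by rewrite exprn_ge0 ?exprn_ile1//; lra.
  rewrite (andP (peak_itv m _)).1 /=; last by rewrite t1; lra.
  rewrite exprVn -[leRHS]mul1r ler_pdivlMr; last by rewrite exprn_gt0//; lra.
  by have := bernoulli_mul (2 ^ m) tm; rewrite natrX -exprMn mulrC.
- exact: cvg_cst.
- apply: cvg_expr; rewrite normfV ger0_norm; last by lra.
  by rewrite invf_lt1; lra.
Unshelve. all: end_near. Qed.

Lemma cosB_half x b :
  cos (x - b / 2) - cos (b / 2) = 2 * (sin (x / 2) * sin ((b - x) / 2)).
Proof.
have -> : x - b / 2 = x / 2 - (b - x) / 2 by field.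
have -> : b / 2 = x / 2 + (b - x) / 2 by field.
by rewrite cosB cosD; ring.
Qed.

(* By [cosB_half], for [0 <= b <= 2 pi] and [0 < x < 2 pi] this is below [1/2]
   exactly when [x < b]. *)
Definition arc_level b x : R := 2^-1 - (cos (x - b / 2) - cos (b / 2)) / 4.

Lemma arc_level_itv b x : 0 <= arc_level b x <= 1.
Proof.
rewrite /arc_level.
have := cos_geN1 (x - b / 2); have := cos_le1 (x - b / 2).
have := cos_geN1 (b / 2); have := cos_le1 (b / 2); lra.
Qed.

Lemma cvg_arc b x : 0 <= b <= 2 * pi -> 0 < x < 2 * pi -> x != b ->
  (fun m => peak m (arc_level b x)) @ \oo --> ((x < b)%R%:R : R).
Proof.
move=> /andP[b0 b1] /andP[x0 x1] xb.
have /andP[l0 l1] := arc_level_itv b x.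
have sx : 0 < sin (x / 2) by apply: sin_gt0_pi; lra.
case: ltrP => [xltb|bx].
- apply: cvg_peak1; rewrite l0 /= /arc_level cosB_half.
  have : 0 < sin ((b - x) / 2) by apply: sin_gt0_pi; lra.
  by move=> /(mulr_gt0 sx); lra.
- apply: cvg_peak0; rewrite l1 andbT /arc_level cosB_half.
  have bx' : b < x by rewrite lt_neqAle eq_sym xb.
  have : 0 < sin ((x - b) / 2) by apply: sin_gt0_pi; lra.
  have -> : (b - x) / 2 = - ((x - b) / 2) by field.
  by rewrite sinN => /(mulr_gt0 sx); lra.
Qed.

Lemma cvg_prod (I : Type) (r : seq I) (f : I -> nat -> R) (l : I -> R) :
  (forall i, f i @ \oo --> l i) ->
  (fun m => \prod_(i <- r) f i m) @ \oo --> \prod_(i <- r) l i.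
Proof.
move=> fl; elim: r => [|i r IH].
  under eq_fun do rewrite big_nil; rewrite big_nil; exact: cvg_cst.
under eq_fun do rewrite big_cons; rewrite big_cons.
exact: cvgM.
Qed.

End step_approximation.

(** * The algebra of trigonometric polynomials *)

Section trigonometric_polynomials.
Context (R : realType) (n : nat).
Local Notation T := 'rV[R]_n.
Implicit Types (f g : T -> R) (k l : 'rV[int]_n).

Definition trigpoly f := exists r : seq ('rV[int]_n * R),
  f = fun x => \sum_(z <- r) z.2 * cas (phase z.1 x).

Lemma trigpolyD f g : trigpoly f -> trigpoly g -> trigpoly (fun x => f x + g x).
Proof.
move=> [r ->] [r' ->]; exists (r ++ r'); apply/funext => x.
by rewrite big_cat.
Qed.

Lemma trigpolyZ a f : trigpoly f -> trigpoly (fun x => a * f x).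
Proof.
move=> [r ->]; exists [seq (z.1, a * z.2) | z <- r]; apply/funext => x.
by rewrite big_map mulr_sumr; apply: eq_bigr => z _; rewrite mulrA.
Qed.

Lemma trigpoly_cas k : trigpoly (fun x => cas (phase k x)).
Proof. by exists [:: (k, 1)]; apply/funext => x; rewrite big_seq1 mul1r. Qed.

Lemma trigpoly_cst a : trigpoly (fun=> a).
Proof.
have := trigpolyZ a (trigpoly_cas 0); congr trigpoly.
by apply/funext => x; rewrite phase0 /cas cos0 sin0 addr0 mulr1.
Qed.

(** Even part of [cas]; the next lemma takes the odd part. *)
Lemma trigpoly_cos k : trigpoly (fun x => cos (phase k x)).
Proof.
have := trigpolyD (trigpolyZ 2^-1 (trigpoly_cas k)) (trigpolyZ 2^-1 (trigpoly_cas (- k))).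
congr trigpoly; apply/funext => x.
by rewrite phaseN /cas cosN sinN; field.
Qed.

Lemma trigpoly_sin k : trigpoly (fun x => sin (phase k x)).
Proof.
have := trigpolyD (trigpolyZ 2^-1 (trigpoly_cas k)) (trigpolyZ (- 2^-1) (trigpoly_cas (- k))).
congr trigpoly; apply/funext => x.
by rewrite phaseN /cas cosN sinN; field.
Qed.

Lemma trigpoly_sum (I : Type) (r : seq I) (F : I -> T -> R) :
  (forall i, trigpoly (F i)) -> trigpoly (fun x => \sum_(i <- r) F i x).
Proof.
move=> hF; elim: r => [|i r IH].
  by under eq_fun do rewrite big_nil; exact: trigpoly_cst.
by under eq_fun do rewrite big_cons; exact: trigpolyD.
Qed.

Lemma trigpolyM f g : trigpoly f -> trigpoly g -> trigpoly (fun x => f x * g x).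
Proof.
move=> [r ->] [r' ->].
under eq_fun do rewrite mulr_suml.
apply: trigpoly_sum => z; under eq_fun do rewrite mulr_sumr.
apply: trigpoly_sum => w.
have := trigpolyZ (z.2 * w.2)
  (trigpolyD (trigpoly_cos (z.1 - w.1)) (trigpoly_sin (z.1 + w.1))).
congr trigpoly; apply/funext => x.
by rewrite mulrACA cas_mul phaseB phaseD.
Qed.

Lemma trigpoly_prod (I : Type) (r : seq I) (F : I -> T -> R) :
  (forall i, trigpoly (F i)) -> trigpoly (fun x => \prod_(i <- r) F i x).
Proof.
move=> hF; elim: r => [|i r IH].
  by under eq_fun do rewrite big_nil; exact: trigpoly_cst.
by under eq_fun do rewrite big_cons; exact: trigpolyM.
Qed.

Lemma trigpolyX f m : trigpoly f -> trigpoly (fun x => f x ^+ m).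
Proof.
move=> hf; have := trigpoly_prod (index_enum 'I_m) (fun=> hf).
by congr trigpoly; apply/funext => x; rewrite prodr_const card_ord.
Qed.

Lemma phase_delta i (x : T) : phase (delta_mx 0 i) x = x 0 i.
Proof.
rewrite /phase (bigD1 i)//= big1 => [|j ji].
  by rewrite mxE !eqxx mul1r addr0.
by rewrite mxE eqxx (negbTE ji) mul0r.
Qed.

Lemma trigpoly_arc m b i : trigpoly (fun x => peak m (arc_level b (x 0 i))).
Proof.
have h : trigpoly (fun x => arc_level b (x 0 i)).
  have := trigpolyD (trigpoly_cst (2^-1 + cos (b / 2) / 4))
   (trigpolyD (trigpolyZ (- (cos (b / 2) / 4)) (trigpoly_cos (delta_mx 0 i)))
              (trigpolyZ (- (sin (b / 2) / 4)) (trigpoly_sin (delta_mx 0 i)))).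
  congr trigpoly; apply/funext => x.
  by rewrite phase_delta /arc_level cosB; field.
apply: trigpolyX; have := trigpolyD (trigpoly_cst 1) (trigpolyZ (-1) (trigpolyX m h)).
by congr trigpoly; apply/funext => x; rewrite mulN1r.
Qed.

Lemma measurable_trigpoly f : trigpoly f -> measurable_fun setT f.
Proof.
move=> [r ->]; apply: measurable_sum => z.
by apply: measurable_funM => //; exact: measurable_cas.
Qed.

End trigonometric_polynomials.

(** * Density of trigonometric polynomials in L2 of the torus *)

Section trigonometric_density.
Context (R : realType) (n : nat).
Local Notation T := 'rV[R]_n.
Local Notation mu := (torus_measure R n).
Local Notation W := ((2 * pi) ^+ n : R).
Implicit Types (u v w : L2 mu) (f g : T -> R).

Let approx v := forall eps : R, 0 < eps ->
  exists r : seq ('rV[int]_n * R), `|v - \sum_(z <- r) z.2 *: hartley R z.1| < eps.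

Let approx_limit v :
  (forall eps : R, 0 < eps -> exists2 u, approx u & `|v - u| < eps) -> approx v.
Proof.
move=> h eps eps0; have e2 : 0 < eps / 2 by rewrite divr_gt0.
have [u /(_ _ e2)[r ur] vu] := h _ e2.
by exists r; apply: le_lt_trans (ler_distD u _ _) _; rewrite [eps]splitr ltrD.
Qed.

Let approxD u v : approx u -> approx v -> approx (u + v).
Proof.
move=> hu hv eps eps0; have e2 : 0 < eps / 2 by rewrite divr_gt0.
have [r ur] := hu _ e2; have [s vs] := hv _ e2.
exists (r ++ s); rewrite big_cat/= opprD addrACA.
by rewrite (le_lt_trans (ler_normD _ _))// [eps]splitr ltrD.
Qed.

Let approxZ a u : approx u -> approx (a *: u).
Proof.
move=> hu eps eps0; have e2 : 0 < eps / (`|a| + 1).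
  by rewrite divr_gt0// ltr_wpDl.
have [r ur] := hu _ e2; exists [seq (z.1, a * z.2) | z <- r].
rewrite big_map; under eq_bigr do rewrite /= -scalerA.
rewrite -scaler_sumr -scalerBr normrZ.
apply: (@le_lt_trans _ _ ((`|a| + 1) * `|u - \sum_(i <- r) i.2 *: hartley R i.1|)).
  by rewrite ler_wpM2r// lerDl.
by move: ur; rewrite ltr_pdivlMr ?ltr_wpDl// mulrC.
Qed.

Let approx_trigpoly u f : trigpoly f -> (u : T -> R) = f %[ae mu] -> approx u.
Proof.
(* The factor sqrt W undoes the normalisation of [hartley]. *)
move=> [r ->] uf eps eps0; exists [seq (z.1, Num.sqrt W * z.2) | z <- r].
suff -> : u = \sum_(z <- [seq (z.1, Num.sqrt W * z.2) | z <- r]) z.2 *: hartley R z.1.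
  by rewrite subrr normr0.
apply/Lspace_eqP; apply: ae_eq_trans uf _; apply: ae_eq_sym.
rewrite big_map; elim: r => [|z r IH].
  rewrite big_nil; under [X in ae_eq _ _ _ X]eq_fun do rewrite big_nil.
  rewrite -(scale0r 0); have := L2Z 0 (0 : L2 mu).
  by apply: filterS => x /(_ I) -> _; rewrite mul0r.
rewrite big_cons; under [X in ae_eq _ _ _ X]eq_fun do rewrite big_cons.
have hz : (((Num.sqrt W * z.2) *: hartley R z.1)%R : T -> R) =
    (fun x => z.2 * cas (phase z.1 x)) %[ae mu].
  have := hartleyE R z.1; have := L2Z (Num.sqrt W * z.2) (hartley R z.1).
  apply: filterS2 => x /(_ I) -> /(_ I) -> _.
  rewrite mulrACA mulfV ?mul1r//.
  by rewrite gt_eqF// sqrtr_gt0 torus_volume_gt0.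
have := L2D ((Num.sqrt W * z.2) *: hartley R z.1)
  (\sum_(j <- r) (Num.sqrt W * j.2) *: hartley R j.1).
by move: IH hz; apply: filterS3 => x /(_ I) h1 /(_ I) h2 /(_ I) h3 _; rewrite h3 h2 h1.
Qed.

(** Bounded almost everywhere convergence implies L2 convergence, since the torus has finite
    measure; the squared differences are dominated by (2 C)^2. *)
Let approx_cvg u (f_ : nat -> T -> R) f (C : R) :
  (forall m w, (w : T -> R) = f_ m %[ae mu] -> approx w) ->
  (forall m, measurable_fun setT (f_ m)) ->
  {ae mu, forall x, forall m, `|f_ m x| <= C} ->
  {ae mu, forall x, `|f x| <= C} ->
  {ae mu, forall x, (fun m => f_ m x) @ \oo --> f x} ->
  (u : T -> R) = f %[ae mu] -> approx u.
Proof.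
move=> af mf fC fC' ff uf; apply: approx_limit => eps eps0.
have ex m : exists w : L2 mu, (w : T -> R) = f_ m %[ae mu].
  apply/L2_of_Lfun2/(@bounded_Lfun2 _ _ _ _ _ C) => //.
    exact: torus_measure_finite.
  by move: fC; apply: filterS => x; exact.
have /choice[w wf] := ex.
have wE : {ae mu, forall x, forall m, (w m x : R) = f_ m x}.
  apply/ae_foralln => m.
  by have := wf m; apply: filterS => x /(_ I).
have uC : {ae mu, forall x, `|u x| <= C}.
  by move: uf fC'; apply: filterS2 => x /(_ I) ->.
have : (fun m => `|w m - u|) @ \oo --> 0.
  apply: (@L2_dominated _ _ _ _ _ _ (fun=> (C + C) ^+ 2)).
  - apply: (bounded_integrable_torus (C := (C + C) ^+ 2)) => //.
    by move=> x; rewrite ger0_norm ?sqr_ge0.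
  - move: uf ff wE; apply: filterS3 => x /(_ I) -> fx wx.
    by under eq_fun do rewrite wx.
  - move: uC fC wE; apply: filterS3 => x ux fx wx m.
    rewrite wx -real_normK ?num_real// ler_sqr ?nnegrE//.
      by rewrite (le_trans (ler_normB _ _))// lerD.
    by rewrite addr_ge0// (le_trans _ ux).
move=> /cvgrPdist_lt/(_ _ eps0)[N _ /(_ N (leqnn N))] /=.
rewrite sub0r normrN normr_id distrC => h.
by exists (w N) => //; apply: af.
Qed.

Let approx_box (b : 'I_n -> R) u :
  (u : T -> R) = \1_[set x : T | forall i, x 0 i < b i] %[ae mu] -> approx u.
Proof.
(* Clamping to [0, 2 pi], the range where [cvg_arc] applies, changes the box only outside the torus
   or on null hyperplanes. *)
pose b' i := Num.max 0 (Num.min (b i) (2 * pi)).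
have pi0 := pi_gt0 R.
have b'P i : 0 <= b' i <= 2 * pi.
  by rewrite le_max lexx/= ge_max ge_min lexx orbT andbT; lra.
apply: (@approx_cvg _ (fun m x => \prod_(i < n) peak m (arc_level (b' i) (x 0 i))) _ 1).
- move=> m w; apply: approx_trigpoly; apply: trigpoly_prod => i.
  exact: trigpoly_arc.
- move=> m; apply: measurable_trigpoly; apply: trigpoly_prod => i.
  exact: trigpoly_arc.
- apply: aeW => x m; rewrite ger0_norm.
    apply: prodr_ile1 => i _.
    exact: peak_itv (arc_level_itv _ _).
  by apply: prodr_ge0 => i _; have /andP[] := peak_itv m (arc_level_itv (b' i) (x 0 i)).
- by apply: aeW => x; rewrite indicE; case: (x \in _); rewrite ?normr1 ?normr0.
- have h0 i := @ae_torus_hyperplane R n i 0.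
  have h1 i := @ae_torus_hyperplane R n i (2 * pi).
  have hb i := @ae_torus_hyperplane R n i (b' i).
  have h : {ae mu, forall x : T, forall i, [/\ x 0 i != 0, x 0 i != 2 * pi & x 0 i != b' i]}.
    apply: filter_forall => i.
    by move: (h0 i) (h1 i) (hb i); apply: filterS3 => x.
  move: h (@ae_torus R n); apply: filterS2 => x hx xT.
  rewrite indicE.
  have -> : ((x \in [set x : T | forall i, x 0 i < b i])%:R : R) =
      \prod_(i < n) (x 0 i < b' i)%R%:R.
    have xb i : (x 0 i < b' i)%R = (x 0 i < b i)%R.
      have [x0 x1 _] := hx i; have /andP[xi0 xi1] := xT i.
      rewrite /b' lt_max lt_min ltNge xi0/=.
      have -> : x 0 i < 2 * pi by rewrite lt_neqAle x1 xi1.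
      by rewrite andbT.
    have [h|/existsNP[i /negP xi]] := pselect (forall i, x 0 i < b i).
      by rewrite mem_set// big1// => i _; rewrite xb h.
    rewrite memNset/=; last by move=> /(_ i); exact/negP.
    by rewrite (bigD1 i)//= xb (negbTE xi) mul0r.
  apply: cvg_prod => i; have [x0 x1 xb] := hx i.
  have /andP[xi0 xi1] := xT i.
  by apply: cvg_arc => //; rewrite !lt_neqAle xi0 xi1 eq_sym x0 x1.
Qed.

Let approx_indic_limit (F : nat -> set T) A u :
  (forall m, measurable (F m)) ->
  (forall m w, (w : T -> R) = \1_(F m) %[ae mu] -> approx w) ->
  nondecreasing_seq F -> A = \bigcup_m F m ->
  (u : T -> R) = \1_A %[ae mu] -> approx u.
Proof.
move=> mF aF ndF ->.
have indic1 (B : set T) x : `|\1_B x : R| <= 1.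
  by rewrite indicE; case: (x \in _); rewrite ?normr1 ?normr0.
apply: (@approx_cvg _ (fun m => \1_(F m)) _ 1) => //.
- by apply: aeW => x m; exact: indic1.
- by apply: aeW => x; exact: indic1.
- apply: aeW => x; have [[N _ FNx]|xF] := pselect ((\bigcup_m F m) x).
    apply: cvg_near_cst; near=> m; rewrite !indicE !mem_set//; first by exists N.
    have : (F N <= F m)%O by apply: ndF; near: m; exact: nbhs_infty_ge.
    by rewrite subsetEset; exact.
  apply: cvg_near_cst; near=> m; rewrite !indicE !memNset//.
  by move=> Fx; apply: xF; exists m.
Unshelve. all: end_near. Qed.

Let box_sets := [set A : set T | exists b : 'I_n -> R, A = [set x | forall i, x 0 i < b i]].

(** A half-space x_i < a is the union over m of the boxes whose other bounds equal m, and
    half-spaces generate the sigma-algebra. *)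
Let measurable_box_sets A : measurable A -> <<s box_sets >> A.
Proof.
apply: smallest_sub; first exact: smallest_sigma_algebra.
move=> B; rewrite -bigcup_seq => -[i _ [D mD <-{B}]]; rewrite setTI.
suff : (@measurable _ (measurableTypeR R)) `<=`
    [set D | <<s box_sets >> (rV_coord i @^-1` D)] by apply.
rewrite RGenInftyO.measurableE.
have [s0 sC sU] := smallest_sigma_algebra setT box_sets.
apply: smallest_sub.
  split => /=.
  - by rewrite preimage_set0.
  - by move=> E sE; rewrite setTD preimage_setC -setTD; exact: sC.
  - by move=> F sF; rewrite preimage_bigcup; exact: sU.
move=> _ [a ->] /=.
rewrite (_ : _ @^-1` _ = \bigcup_m [set x : T | forall j, x 0 j < if j == i then a else m%:R]).
  apply: sU => m; apply: sub_gen_smallest.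
  by exists (fun j => if j == i then a else m%:R).
apply/seteqP; split => x /=; rewrite in_itv/=.
  move=> xa; exists (Num.trunc (\sum_(j < n) `|x 0 j|)).+1 => //= j.
  case: ifPn => [/eqP ->//|ji].
  rewrite (le_lt_trans (ler_norm _))// (le_lt_trans _ (truncnS_gt _))//.
  by rewrite (bigD1 j)//= lerDl sumr_ge0.
by move=> [m _ /(_ i)]; rewrite eqxx.
Qed.

Let measurable_box (b : 'I_n -> R) : measurable [set x : T | forall i, x 0 i < b i].
Proof.
rewrite (_ : [set x | _] = \big[setI/setT]_(i < n) (rV_coord i @^-1` `]-oo, b i[)).
  apply: big_ind => //; first by move=> B D mB mD; exact: measurableI.
  by move=> i _; rewrite -[X in measurable X]setTI; exact: measurable_rV_coord.
apply/seteqP; split => x /=.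
  by move=> h; rewrite -bigcap_seq => i _ /=; rewrite in_itv /=; exact: h.
rewrite -bigcap_seq => h i; have := h i; rewrite /= in_itv /=; apply.
by rewrite mem_index_enum.
Qed.

(** Boxes are stable under intersection. The sets whose indicator is approximable form a
    lambda-system: differences by linearity, increasing unions by [approx_indic_limit]. *)
Let approx_indic A u : measurable A -> (u : T -> R) = \1_A %[ae mu] -> approx u.
Proof.
pose H := [set A : set T | measurable A /\
  forall u, (u : T -> R) = \1_A %[ae mu] -> approx u].
suff : measurable `<=` H by move=> /[apply] -[_]; exact.
have indic_ex (B : set T) : measurable B -> exists w, (w : T -> R) = \1_B %[ae mu].
  move=> mB; apply/L2_of_Lfun2/(@bounded_Lfun2 _ _ _ _ _ 1) => //.
  - exact: torus_measure_finite.
  - by apply: aeW => x; rewrite indicE; case: (x \in _); rewrite ?normr1 ?normr0.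
apply: subset_trans measurable_box_sets _.
apply: lambda_system_subset.
- move=> _ _ [b ->] [c ->]; exists (fun i => Num.min (b i) (c i)).
  apply/seteqP; split => x /=.
    by move=> [xb xc] i; rewrite lt_min xb xc.
  by move=> h; split => i; have := h i; rewrite lt_min => /andP[].
- split => //.
  + split => // w; apply: approx_trigpoly; rewrite indicT; exact: trigpoly_cst.
  + move=> B D DB [mB aB] [mD aD]; split; first exact: measurableD.
    move=> w wE; have [wB wBE] := indic_ex _ mB; have [wD wDE] := indic_ex _ mD.
    have -> : w = wB + (-1) *: wD.
      apply/Lspace_eqP.
      have h : ((wB + (-1) *: wD)%R : T -> R) = \1_(B `\` D) %[ae mu].
        have hD : (((-1) *: wD)%R : T -> R) = (fun x => - \1_D x) %[ae mu].
          move: wDE (L2Z (-1) wD); apply: filterS2 => x /(_ I) -> /(_ I) -> _.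
          by rewrite mulN1r.
        move: wBE hD (L2D wB (-1 *: wD)).
        apply: filterS3 => x /(_ I) hB /(_ I) {}hD /(_ I) -> _.
        rewrite hB hD !indicE in_setD; have [xD|xD] := boolP (x \in D).
          by rewrite (mem_set (DB _ (set_mem xD))) subrr.
        by rewrite subr0 andbT.
      by move: wE h; apply: filterS2 => x /(_ I) -> /(_ I) ->.
    by apply: approxD; [exact: aB|apply: approxZ; exact: aD].
  + move=> F ndF HF; split.
      by apply: bigcupT_measurable => m; have [] := HF m.
    move=> w; apply: (approx_indic_limit (F := F)) => //.
    * by move=> m; have [] := HF m.
    * by move=> m; have [] := HF m.
- by move=> _ [b ->]; split; [exact: measurable_box|move=> w; exact: approx_box].
- by [].
Qed.

Import HBNNSimple.

Let approx_sum_indic (r : seq R) (F : R -> set T) u :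
  (forall a, measurable (F a)) ->
  (u : T -> R) = (fun x => \sum_(a <- r) a * \1_(F a) x) %[ae mu] -> approx u.
Proof.
move=> mF; have /choice[w wF] a : exists w : L2 mu, (w : T -> R) = \1_(F a) %[ae mu].
  apply/L2_of_Lfun2/(@bounded_Lfun2 _ _ _ _ _ 1) => //.
  - exact: torus_measure_finite.
  - by apply: aeW => x; rewrite indicE; case: (x \in _); rewrite ?normr1 ?normr0.
elim: r u => [|a r IH] u uE.
  apply: approx_trigpoly uE; under eq_fun do rewrite big_nil.
  exact: trigpoly_cst.
have -> : u = a *: w a + (u - a *: w a) by rewrite addrCA subrr addr0.
apply: approxD; first by apply: approxZ; apply: approx_indic (wF a).
apply: IH; move: uE (L2B u (a *: w a)) => uE uB.
have hZ : ((a *: w a)%R : T -> R) = (fun x => a * \1_(F a) x) %[ae mu].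
  by move: (wF a) (L2Z a (w a)); apply: filterS2 => x /(_ I) -> /(_ I) ->.
move: uE uB hZ; apply: filterS3 => x /(_ I) h1 /(_ I) -> /(_ I) -> _.
by rewrite h1 big_cons addrC addKr.
Qed.

Let approx_nnsfun (g : {nnsfun T >-> R}) u :
  (u : T -> R) = g %[ae mu] -> approx u.
Proof.
move=> ug.
have [r gE] : exists r : seq R, forall x, g x = \sum_(a <- r) a * \1_(g @^-1` [set a]) x.
  exists (finmap.enum_fset (fset_set (range g))) => x.
  by rewrite fimfunE fsbig_finite.
apply: (@approx_sum_indic r (fun a => g @^-1` [set a]) u).
  by move=> a; rewrite -[X in measurable X]setTI; exact: measurable_funPT.
by move: ug; apply: filterS => x /(_ I) -> _; exact: gE.
Qed.

(** Simple functions g_m increase to f with 0 <= g_m <= f, so the squared differences are dominated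
    by f^2. *)
Let approx_ge0 u f : measurable_fun setT f -> (forall x, 0 <= f x) ->
  (u : T -> R) = f %[ae mu] -> approx u.
Proof.
move=> mf f0 uf; apply: approx_limit => eps eps0.
have mEf : measurable_fun setT (EFin \o f) by apply/measurable_EFinP.
pose g := nnsfun_approx measurableT mEf.
have gf m x : g m x <= f x.
  by rewrite /g nnsfun_approxE -lee_fin; apply: le_approx => // y _; rewrite lee_fin.
have /choice[w wg] m : exists w : L2 mu, (w : T -> R) = g m %[ae mu].
  have [C [_ gC]] := simple_bounded (g m).
  apply/L2_of_Lfun2/(@bounded_Lfun2 _ _ _ _ _ (C + 1)) => //.
    exact: torus_measure_finite.
  by apply: aeW => x; apply: gC => //; rewrite ltrDl.
have wE : {ae mu, forall x, forall m, (w m x : R) = g m x}.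
  by apply/ae_foralln => m; have := wg m; apply: filterS => x /(_ I).
have : (fun m => `|w m - u|) @ \oo --> 0.
  apply: (L2_dominated (L2_mul_integrable u u)).
  - move: uf wE; apply: filterS2 => x /(_ I) -> wx.
    under eq_fun do rewrite wx.
    have Ef0 y : setT y -> (0 <= (EFin \o f) y)%E by rewrite lee_fin.
    by have /fine_cvgP[_] := cvg_nnsfun_approx measurableT mEf Ef0 (I : setT x).
  - move: uf wE; apply: filterS2 => x /(_ I) -> wx m.
    rewrite -expr2 wx -real_normK ?num_real// ler_sqr ?nnegrE//.
    rewrite ler0_norm ?subr_le0// opprB lerBlDr lerDl.
    exact: fun_ge0.
move=> /cvgrPdist_lt/(_ _ eps0)[N _ /(_ N (leqnn N))] /=.
rewrite sub0r normrN normr_id distrC => h.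
by exists (w N) => //; exact: approx_nnsfun (wg N).
Qed.

(** Positive part minus negative part, the latter written as [vp - v]. *)
Lemma hartley_dense v (eps : R) : 0 < eps ->
  exists r : seq ('rV[int]_n * R), `|v - \sum_(z <- r) z.2 *: hartley R z.1| < eps.
Proof.
suff : approx v by exact.
have mv := measurable_L2 v.
have [vp vpE] : exists w : L2 mu, (w : T -> R) = (fun x => Num.max (v x) 0) %[ae mu].
  apply/L2_of_Lfun2/sqr_integrable_Lfun2; first exact: measurable_maxr.
  apply: le_integrable (L2_mul_integrable v v) => //.
    by apply/measurable_EFinP; apply: measurable_funX; exact: measurable_maxr.
  move=> x _; rewrite /= lee_fin -expr2 !normrX ler_sqr ?nnegrE//.
  by rewrite maxEle; case: ifPn => // _; rewrite normr0.
have -> : v = vp + (-1) *: (vp - v).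
  by rewrite scaleN1r opprB addrCA subrr addr0.
apply: approxD.
  apply: approx_ge0 vpE; first exact: measurable_maxr.
  by move=> x; rewrite le_max lexx orbT.
apply/approxZ/(@approx_ge0 _ (fun x => Num.max (v x) 0 - v x)).
- by apply: measurable_funB => //; exact: measurable_maxr.
- by move=> x; rewrite subr_ge0 le_max lexx.
by move: vpE (L2B vp v); apply: filterS2 => x /(_ I) -> /(_ I) ->.
Qed.

End trigonometric_density.

(** * Approximation of the Hartley basis by trunk nets *)

Section frequencies.
Context (n : nat).

Definition frequency_box (M : nat) : seq 'rV[int]_n :=
  [seq \row_i ((f i : nat)%:Z - M%:Z) | f : {ffun 'I_n -> 'I_(M.*2.+1)}].

Lemma mem_frequency_box M (k : 'rV[int]_n) :
  (k \in frequency_box M) = [forall i, (`|k 0%R i| <= M)%N].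
Proof.
apply/mapP/forallP => [[f _ ->] i|h].
  rewrite mxE; move: (f i) => [a /= a_lt]; lia.
have kM i : (`|(k 0 i + M%:Z)%R| < M.*2.+1)%N by have := h i; lia.
exists [ffun i => Ordinal (kM i)]; first by rewrite mem_enum.
by apply/rowP => i; rewrite mxE ffunE /=; have := h i; lia.
Qed.

Lemma frequency_box_uniq M : uniq (frequency_box M).
Proof.
rewrite map_inj_uniq ?enum_uniq// => f g fg; apply/ffunP => i; apply: val_inj.
have := congr1 (fun v : 'rV_n => v 0 i) fg; rewrite !mxE => /=; lia.
Qed.

Lemma size_frequency_box M : size (frequency_box M) = (M.*2.+1 ^ n)%N.
Proof. by rewrite size_map -cardE card_ffun !card_ord. Qed.

(** [N] is maximal with (2 N + 1)^n <= p. Listing its box first and then the rest of the next box,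
    the first [p] entries contain all of the smaller one; maximality gives p < (2 N + 3)^n. *)
Lemma frequency_selection p : (0 < n)%N -> (0 < p)%N ->
  exists (N : nat) (kappa : 'I_p -> 'rV[int]_n), [/\ injective kappa,
    forall k, k \in frequency_box N -> exists j, kappa j = k,
    forall j, kappa j \in frequency_box N.+1,
    (p < (3 * N.+1) ^ n)%N & (N < p)%N].
Proof.
move=> n0 p0.
have lt_exp M : (M < M.*2.+1 ^ n)%N.
  rewrite (@leq_trans (M.*2.+1))//; first lia.
  by rewrite -[X in (X <= _)%N]expn1 leq_pexp2l.
have exP : exists N, (N.*2.+1 ^ n <= p)%N by exists 0; rewrite exp1n.
have ubP N : (N.*2.+1 ^ n <= p)%N -> (N <= p)%N.
  by move=> h; rewrite ltnW// (leq_trans (lt_exp N)).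
have [N Np Nmax] := ex_maxnP exP ubP.
have pN : (p < N.*2.+3 ^ n)%N.
  by rewrite ltnNge; apply/negP => h; have := Nmax N.+1 h; rewrite ltnn.
pose s1 := frequency_box N; pose s2 := frequency_box N.+1.
pose s := s1 ++ [seq x <- s2 | x \notin s1].
have us : uniq s.
  rewrite cat_uniq frequency_box_uniq filter_uniq ?frequency_box_uniq// andbT.
  by apply/hasPn => x; rewrite mem_filter => /andP[].
have ps : (p < size s)%N.
  apply: (leq_trans (n := size s2)); first by rewrite size_frequency_box.
  apply: uniq_leq_size; first exact: frequency_box_uniq.
  by move=> x xs; rewrite mem_cat mem_filter xs andbT orbN.
exists N, (fun j => nth 0 s j); split => //.
- move=> i j /eqP; rewrite nth_uniq ?(ltn_trans _ ps)// => /eqP ij.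
  exact: val_inj.
- move=> k ks1; have kp : (index k s1 < p)%N.
    by rewrite (leq_trans _ Np)// -size_frequency_box index_mem.
  exists (Ordinal kp) => /=.
  by rewrite nth_cat index_mem ks1 nth_index.
- move=> j; have : nth 0 s j \in s by rewrite mem_nth// (ltn_trans _ ps).
  rewrite mem_cat mem_filter => /orP[|/andP[]//].
  rewrite !mem_frequency_box => /forallP h; apply/forallP => i.
  exact: leqW.
- by rewrite (leq_trans pN)// leq_exp2r//; lia.
- by rewrite (leq_trans (lt_exp N)).
Qed.

End frequencies.

Section hartley_net.
Context (R : realType) (n p : nat) (kappa : 'I_p -> 'rV[int]_n) (K m : nat).
Hypothesis kappaK : forall j, kappa j \in frequency_box n K.
Local Notation W := ((2 * pi) ^+ n : R).
Local Notation T := 'rV[R]_n.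
Local Notation Y := (4 * pi * (n%:R * K%:R + 1) : R).
Hypothesis Ym : Y <= 2 ^+ m.+1.

(* The shift by a multiple of [2 pi] makes the angle nonnegative on the torus. *)
Let shift : R := 2 * pi * (n%:R * K%:R + 1) - pi / 4.

(** Of the [m.+1] halvings, [m] are undone by angle doublings, and one comes from cos(2 z) = 1 - 2
    sin^2 z. *)
Let angle j (x : T) : R := (phase (kappa j) x + shift) / 2 ^+ m.+1.

Let angle_itv j x : torus R n x -> 0 <= angle j x <= Y / 2 ^+ m.+1.
Proof.
move=> xT; have pi0 := pi_gt0 R.
have : `|phase (kappa j) x| <= 2 * pi * (n%:R * K%:R).
  rewrite (le_trans (ler_norm_sum _ _ _))//.
  have -> : 2 * pi * (n%:R * K%:R) = \sum_(i < n) (K%:R * (2 * pi)) :> R.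
    by rewrite sumr_const card_ord -mulr_natl; ring.
  apply: ler_sum => i _; have /andP[x0 x1] := xT i.
  rewrite normrM (ger0_norm x0) ler_pM//.
  have := kappaK j; rewrite mem_frequency_box => /forallP/(_ i).
  by rewrite -intr_norm -natr_absz ler_nat.
rewrite ler_norml => /andP[h0 h1].
rewrite /angle ler_wpM2r ?invr_ge0 ?exprn_ge0// ?andbT; last by rewrite /shift; lra.
by rewrite mulr_ge0 ?invr_ge0 ?exprn_ge0// /shift; lra.
Qed.

Let cst : R := (Num.sqrt W)^-1 * Num.sqrt 2.

(** Computes cst (1 - 2 sin^2). With 2 m tent maps the truncation error 4^(-2 m), amplified by 4^m,
    is again of order 4^(-m). *)
Let body := sine_net (2 * m) m (- (2 * cst)) cst.

(** Three equal columns: with [bias], all neurons receive the angle, the middle one lowered by 1/2,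
    which is the initial [state]. *)
Let weight j : 'M[R]_(n, 3) := \matrix_(i, l) ((kappa j 0 i)%:~R / 2 ^+ m.+1).

Let bias : 'rV[R]_3 := \row_(l < 3) (shift / 2 ^+ m.+1 - nth 0 [:: 0; 2^-1; 0] l).

Let first_layer j x : torus R n x ->
  relu (affine (weight j) bias x) = state (angle j x) (angle j x).
Proof.
move=> /(angle_itv j)/andP[a0 _]; apply/rowP => l; rewrite /relu /affine !mxE.
have -> : \sum_(i < n) x 0 i * weight j i l = phase (kappa j) x / 2 ^+ m.+1.
  rewrite /phase mulr_suml; apply: eq_bigr => i _.
  by rewrite mxE mulrA (mulrC (x 0 i)).
rewrite addrA -mulrDl -/(angle j x).
case: l => [[|[|[|//]]] ?] /=; rewrite ?subr0//; exact/max_idPl.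
Qed.

Let cast_angle j x : cas (phase (kappa j) x) =
  Num.sqrt 2 * (1 - 2 * sin (2 ^+ m * angle j x) ^+ 2).
Proof.
rewrite casE; congr (_ * _).
have -> : phase (kappa j) x - pi / 4 =
    (- (n * K).+1%:Z)%:~R * (2 * pi) + (2 ^+ m * angle j x) *+ 2.
  have -> : (- (n * K).+1%:Z)%:~R = - (n%:R * K%:R + 1) :> R.
    by rewrite mulrNz -pmulrn -natr1 natrM.
  rewrite /angle /shift (exprS 2 m).
  have : 2 ^+ m != 0 :> R by rewrite expf_neq0.
  by move: (2 ^+ m) (n%:R) (K%:R) => e n' K' e0; field.
rewrite periodic_int; last exact: cosD2pi.
rewrite cos_mulr2n; have := cos2Dsin2 (2 ^+ m * angle j x).
by move=> /(canRL (addrK _)) ->; ring.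
Qed.

(** The fourth power in [sin_sqr_approx] outweighs the amplification: the left side is y^4 / (16 *
    4^m). *)
Let pow4 (y : R) : 4 ^+ m * (y / 2 ^+ m.+1) ^+ 4 <= y ^+ 4 * (4^-1) ^+ m.
Proof.
have E : 4 ^+ m = (2 ^+ m) ^+ 2 :> R by rewrite -exprM mulnC exprM; congr (_ ^+ _); ring.
rewrite exprVn E (exprS 2 m); have : 2 ^+ m != 0 :> R by rewrite expf_neq0.
move: (2 ^+ m) => z z0.
have -> : z ^+ 2 * (y / (2 * z)) ^+ 4 = y ^+ 4 / z ^+ 2 / 16 by field.
have : 0 <= y ^+ 4 / z ^+ 2 by rewrite mulr_ge0 ?invr_ge0 ?sqr_ge0// exprn_even_ge0.
by lra.
Qed.

(** The pointwise error on the torus is at most 2 cst eps. Since cst^2 W = 2, its squared L2 norm is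
    at most 8 eps^2, and 8 <= 3^2. *)
Lemma hartley_net : exists tau : relu_net R n p,
  [/\ (net_size tau <= p * (n * 3 + 3 + (12 * (m.+1 * (2 * m).+1) + 4)))%N,
      net_depth tau = (m.+1 * (2 * m).+1).+1 &
      forall j, `|trunk tau j - hartley R (kappa j)| <= 3 * ((Y ^+ 4 + 2) * (4^-1) ^+ m)].
Proof.
have [tau [taue taus taud]] := net_parallel body weight (fun=> bias).
exists tau; split.
- rewrite (leq_trans taus)// leq_mul2l leq_add2l sine_net_size orbT//.
- by rewrite taud sine_net_depth.
move=> j; have pi0 := pi_gt0 R; have W0 := torus_volume_gt0 R n.
set eps := (Y ^+ 4 + 2) * (4^-1) ^+ m.
have Y4 : 0 <= Y ^+ 4 by exact: exprn_even_ge0.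
have eps0 : 0 <= eps by rewrite mulr_ge0 ?exprn_ge0 ?addr_ge0.
have c0 : 0 <= cst by rewrite mulr_ge0 ?invr_ge0 ?sqrtr_ge0.
have pw x : torus R n x ->
    `|net_eval tau x 0 j - (Num.sqrt W)^-1 * cas (phase (kappa j) x)| <= 2 * cst * eps.
  move=> xT; have /andP[a0 aY] := angle_itv j xT.
  have a1 : angle j x <= 1.
    by rewrite (le_trans aY)// ler_pdivrMr ?mul1r// exprn_gt0.
  rewrite taue first_layer// sine_netE ?a0// cast_angle.
  have := @sin_sqr_net_error R m (2 * m) (angle j x); rewrite a0 => /(_ a1).
  set u := iter _ _ _; set v := sin _ ^+ 2 => uv.
  have -> : - (2 * cst) * u + cst - (Num.sqrt W)^-1 * (Num.sqrt 2 * (1 - 2 * v)) =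
      - (2 * cst) * (u - v) by rewrite /cst; ring.
  have c2 : 0 <= 2 * cst by rewrite mulr_ge0.
  rewrite normrM normrN (ger0_norm c2); apply: ler_wpM2l => //.
  rewrite (le_trans uv)// /eps.
  have e4 : 4 ^+ m * (4^-1) ^+ (2 * m) = (4^-1) ^+ m :> R.
    by rewrite mul2n -addnn exprD mulrA -exprMn mulfV// expr1n mul1r.
  have a4 : 4 ^+ m * angle j x ^+ 4 <= Y ^+ 4 * (4^-1) ^+ m.
    have : angle j x ^+ 4 <= (Y / 2 ^+ m.+1) ^+ 4 by rewrite lerXn2r ?nnegrE// (le_trans a0).
    have p4 : 0 <= 4 ^+ m :> R by rewrite exprn_ge0.
    by move=> /(ler_wpM2l p4)/le_trans; apply; exact: pow4.
  move: a4 e4; move: (Y ^+ 4) (angle j x ^+ 4) (4 ^+ m) ((4^-1) ^+ m) ((4^-1) ^+ (2 * m)).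
  by move=> y t f g h; lra.
have : `|trunk tau j - hartley R (kappa j)| ^+ 2 <= (2 * cst * eps) ^+ 2 * W.
  have muT : fine (torus_measure R n setT) = W by rewrite torus_measure_setT.
  rewrite -[X in _ <= _ * X]muT; apply: norm_le_ae_bounded.
  - by apply: mulr_ge0 => //; apply: mulr_ge0.
  - exact: torus_measure_finite.
  have h : {ae torus_measure R n, forall x, (trunk tau j - hartley R (kappa j))%R x =
      net_eval tau x 0 j - (Num.sqrt W)^-1 * cas (phase (kappa j) x) :> R}.
    move: (L2B (trunk tau j) (hartley R (kappa j))) (trunkE tau j) (hartleyE R (kappa j)).
    by apply: filterS3 => x /(_ I) -> /(_ I) -> /(_ I) ->.
  by move: h (@ae_torus R n); apply: filterS2 => x -> /pw.
have aux (c e w : R) : c ^+ 2 * w = 2 -> (2 * c * e) ^+ 2 * w = 8 * e ^+ 2.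
  move=> cw; transitivity (4 * e ^+ 2 * (c ^+ 2 * w)); first by ring.
  by rewrite cw; ring.
rewrite aux; last first.
  rewrite /cst exprMn exprVn !sqr_sqrtr ?(ltW W0)// mulrAC mulVf ?mul1r//.
  by rewrite gt_eqF.
move=> h; rewrite -ler_sqr ?nnegrE// ?(mulr_ge0 _ eps0)//.
rewrite exprMn (le_trans h)// ler_wpM2r ?sqr_ge0//; lra.
Qed.

End hartley_net.

(** * Hartley coefficients of functions in H^s *)

Section sobolev_tail.
Context (R : realType) (n : nat).
Implicit Types (v : L2 (torus_measure R n)) (k : 'rV[int]_n).
Local Notation W := ((2 * pi) ^+ n : R).

Let weight s k : R := (1 + \sum_(i < n) (k 0 i)%:~R ^+ 2) `^ s.

(** On [G] the Sobolev weight over [lambda] is at least 1, so it can be inserted in the sum; the 2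
    is that of [inner_hartley_le]. *)
Lemma hartley_coef_sum s v (lambda : R) (G : seq 'rV[int]_n) : 0 < lambda ->
  (Hs_norm s v < +oo)%E -> uniq G ->
  {in G, forall k, lambda <= (1 + \sum_(i < n) (k 0 i)%:~R ^+ 2) `^ s} ->
  \sum_(k <- G) inner v (hartley R k) ^+ 2 <= 2 / lambda * fine (Hs_norm s v) ^+ 2.
Proof.
move=> l0 voo uG Gl; have W0 := torus_volume_gt0 R n.
pose c k := weight s k * Normc.normc (fourier_coef v k) ^+ 2.
have c0 k : 0 <= c k by rewrite mulr_ge0 ?powR_ge0 ?sqr_ge0.
set S := (W%:E * \esum_(k in [set: 'rV[int]_n]) (c k)%:E)%E.
have S0 : (0 <= S)%E.
  by apply: mule_ge0; [rewrite lee_fin ltW|apply: esum_ge0 => k _; rewrite lee_fin].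
have HE : Hs_norm s v = (S `^ 2^-1)%E by [].
have Soo : (S < +oo)%E.
  by rewrite (@lty_poweRy _ _ 2^-1).
have HS : fine (Hs_norm s v) ^+ 2 = fine S.
  rewrite HE fine_poweR -powR_mulrn ?powR_ge0// -powRrM mulVf//.
  by rewrite powRr1// fine_ge0.
have GS : W * \sum_(k <- G) c k <= fine S.
  rewrite -lee_fin fineK ?ge0_fin_numE// EFinM lee_wpmul2l ?lee_fin ?(ltW W0)//.
  rewrite -sumEFin; apply: esum_ge.
  exists [set` G].
    by split => //; exact: finite_seq.
  by rewrite fsbig_seq//.
apply: (@le_trans _ _ (2 / lambda * (W * \sum_(k <- G) c k))); last first.
  by rewrite HS ler_wpM2l// divr_ge0// ltW.
rewrite !mulr_sumr big_seq [leRHS]big_seq; apply: ler_sum => k kG.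
rewrite (le_trans (inner_hartley_le v k))// /c.
have := ler_wpM2r (mulr_ge0 (ltW W0) (sqr_ge0 (Normc.normc (fourier_coef v k)))) (Gl k kG).
rewrite -/(weight s k); move: (weight s k) (Normc.normc _ ^+ 2) W => w f V h.
have -> : 2 / lambda * (V * (w * f)) = 2 * (w * (V * f)) / lambda.
  by field; rewrite gt_eqF.
by rewrite ler_pdivlMr//; lra.
Qed.

(** The tail bound for an empty [F], with every weight at least 1. *)
Lemma norm_le_Hs s v : 0 < s -> (Hs_norm s v < +oo)%E ->
  `|v| <= 2 * fine (Hs_norm s v).
Proof.
move=> s0 voo; have H0 : 0 <= fine (Hs_norm s v) by rewrite fine_ge0// poweR_ge0.
rewrite -ler_sqr ?nnegrE ?mulr_ge0//.
apply: (@le_trans _ _ (2 * fine (Hs_norm s v) ^+ 2)); last first.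
  by have := sqr_ge0 (fine (Hs_norm s v)); lra.
have := @orthonormal_basis_tail _ _ _ _ _ (@hartley R n) (@hartley_orthonormal R n)
  (@hartley_dense R n) [::] v (2 * fine (Hs_norm s v) ^+ 2) isT.
rewrite big_nil subr0; apply => G uG _.
rewrite -[2 in leRHS]divr1; apply: hartley_coef_sum => // k _.
rewrite [leLHS](_ : _ = 1 `^ s); last by rewrite powR1.
apply: ge0_ler_powR; rewrite ?nnegrE ?(ltW s0)//.
  by rewrite addr_ge0// sumr_ge0// => i _; exact: sqr_ge0.
by rewrite lerDl sumr_ge0// => i _; exact: sqr_ge0.
Qed.

(** A frequency outside the box has a component of modulus at least N + 1, so its weight is at least
    (N + 1)^(2 s). *)
Lemma hartley_tail s v (N : nat) (F : seq 'rV[int]_n) : 0 < s ->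
  (Hs_norm s v < +oo)%E -> uniq F -> {subset frequency_box n N <= F} ->
  `|v - \sum_(k <- F) inner v (hartley R k) *: hartley R k| ^+ 2 <=
  2 * (N.+1%:R `^ (- s) * fine (Hs_norm s v)) ^+ 2.
Proof.
move=> s0 voo uF NF.
have l0 : 0 < (N.+1%:R `^ s) ^+ 2 :> R by rewrite exprn_gt0// powR_gt0.
rewrite exprMn powRN exprVn mulrA.
apply: (orthonormal_basis_tail (@hartley_orthonormal R n) (@hartley_dense R n)) => //.
move=> G uG GF; apply: hartley_coef_sum => // k /GF kF.
have : k \notin frequency_box n N by apply: contra kF; exact: NF.
rewrite mem_frequency_box; case/forallPn => i; rewrite -ltnNge => ki.
rewrite -powR_mulrn ?powR_ge0// -powRrM mulrC powRrM powR_mulrn//.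
apply: ge0_ler_powR; rewrite ?nnegrE ?(ltW s0)//.
  by rewrite addr_ge0// sumr_ge0// => j _; exact: sqr_ge0.
rewrite (bigD1 i)//= ler_wpDl// ler_wpDr//.
  by rewrite sumr_ge0// => j _; exact: sqr_ge0.
rewrite -[leRHS]real_normK ?num_real// ler_sqr ?nnegrE//.
by rewrite -intr_norm -natr_absz ler_nat.
Qed.

End sobolev_tail.

(** * Choice of the depth and the reconstruction error *)

Lemma pow2_ge_log (R : realType) (X : R) : 1 <= X ->
  exists m : nat, X <= 2 ^+ m /\ m.+1%:R <= ln X / ln 2 + 2.
Proof.
move=> X1; have l2 : 0 < ln 2 :> R by rewrite ln_gt0// ltr1n.
have X0 : 0 < X by rewrite (lt_le_trans ltr01).
have q0 : 0 <= ln X / ln 2 by apply: divr_ge0; [exact: ln_ge0|exact: ltW].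
exists (Num.trunc (ln X / ln 2)).+1; split.
  rewrite -[leLHS](lnK X0) -[X in X ^+ _](@lnK R 2) ?posrE//.
  rewrite -expRM_natl ler_expR -ler_pdivrMr//.
  exact/ltW/truncnS_gt.
have := truncn_le (ln X / ln 2); rewrite q0 -!natr1; lra.
Qed.

(** A number of doublings logarithmic in [p] suffices: 2^m only has to exceed a fixed power of [p].
    The same [m] serves every [K <= p]. *)
Lemma depth_choice (R : realType) (n : nat) (a : R) : 0 < a ->
  exists C : R, 0 < C /\ forall p : nat, (0 < p)%N -> exists m : nat,
    m.+1%:R <= C * (1 + ln p%:R) /\
    forall K : nat, (K <= p)%N -> let Y := 4 * pi * (n%:R * K%:R + 1) in
      Y <= 2 ^+ m.+1 /\
      p%:R * (3 * ((Y ^+ 4 + 2) * (4^-1) ^+ m)) <= 2^-1 * p%:R `^ (- a).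
Proof.
move=> a0; have pi0 := pi_gt0 R.
have l2 : 0 < ln 2 :> R by rewrite ln_gt0// ltr1n.
pose c1 : R := 4 * pi * (n%:R + 1).
have pi4 : 0 <= 4 * pi :> R by rewrite mulr_ge0// ltW.
have c10 : 0 <= c1 by rewrite mulr_ge0// addr_ge0.
(* The first summand serves the error bound, with 6 = 3 * 2, and the second the bound
   [Y <= c1 * p]. *)
pose c2 : R := 6 * (c1 ^+ 4 + 2) + c1.
have c21 : 1 <= c2 by rewrite /c2; have := exprn_ge0 4 c10; lra.
have lc2 := ln_ge0 c21.
(* Read off from ln X = ln c2 + (5 + a) ln p for the [X] below; the 2 is that of [pow2_ge_log]. *)
exists ((ln c2 + 5 + a) / ln 2 + 2); split.
  by rewrite ltr_wpDl// divr_ge0 ?(ltW l2)//; lra.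
move=> p p0; have p1 : 1 <= p%:R :> R by rewrite ler1n.
have p0R : 0 < p%:R :> R by rewrite ltr0n.
have lp := ln_ge0 p1.
have pa1 : 1 <= p%:R `^ a.
  rewrite [leLHS](_ : _ = 1 `^ a); last by rewrite powR1.
  by apply: ge0_ler_powR; rewrite ?nnegrE// ltW.
(* One factor p is the prefactor of the bound, p^4 comes from Y^4, and p^a is the required rate. *)
pose X := c2 * p%:R ^+ 5 * p%:R `^ a.
have X1 : 1 <= X by rewrite !mulr_ege1// exprn_ege1.
have [m [Xm mX]] := pow2_ge_log X1; exists m; split.
  apply: (le_trans mX).
  have -> : ln X = ln c2 + 5 * ln p%:R + a * ln p%:R.
    have c20 : 0 < c2 by rewrite (lt_le_trans ltr01).
    rewrite /X lnM ?posrE ?mulr_gt0 ?exprn_gt0 ?powR_gt0// lnM ?posrE ?exprn_gt0//.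
    by rewrite lnXn// ln_powR mulr_natl.
  have : (ln c2 + 5 * ln p%:R + a * ln p%:R) / ln 2 <=
      (ln c2 + 5 + a) / ln 2 * (1 + ln p%:R).
    rewrite mulrAC ler_wpM2r ?invr_ge0 ?(ltW l2)//.
    by have := mulr_ge0 lc2 lp; lra.
  by lra.
move=> K Kp Y.
have Kp' : K%:R <= p%:R :> R by rewrite ler_nat.
have Yp : Y <= c1 * p%:R.
  rewrite /Y /c1 -[leRHS]mulrA ler_wpM2l//.
  by have := ler_wpM2l (ler0n R n) Kp'; lra.
have Y0 : 0 <= Y by rewrite mulr_ge0// addr_ge0// mulr_ge0.
have pp : p%:R <= p%:R ^+ 5 * p%:R `^ a.
  rewrite exprS -mulrA -[leLHS]mulr1 ler_wpM2l ?(ltW p0R)// mulr_ege1 ?exprn_ege1//.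
split.
  rewrite (le_trans Yp)// (@le_trans _ _ X)//.
    rewrite /X -mulrA ler_pM ?(ltW p0R)// /c2 lerDr.
    by have := exprn_ge0 4 c10; lra.
  by rewrite (le_trans Xm)// ler_eXn2l ?ler1n// ltr1n.
have Y4 : Y ^+ 4 + 2 <= (c1 ^+ 4 + 2) * p%:R ^+ 4.
  have : Y ^+ 4 <= (c1 * p%:R) ^+ 4 by rewrite lerXn2r ?nnegrE// mulr_ge0// ltW.
  have : 1 <= p%:R ^+ 4 :> R by rewrite exprn_ege1.
  by rewrite exprMn; lra.
have key : 6 * (p%:R * p%:R `^ a * (Y ^+ 4 + 2)) <= 4 ^+ m.
  apply: (@le_trans _ _ (6 * (c1 ^+ 4 + 2) * p%:R ^+ 5 * p%:R `^ a)).
    have := ler_wpM2l (mulr_ge0 (ltW p0R) (powR_ge0 p%:R a)) Y4.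
    by rewrite (exprS _ 4); lra.
  apply: (@le_trans _ _ X).
    by rewrite /X ler_wpM2r ?powR_ge0// ler_wpM2r ?exprn_ge0 ?(ltW p0R)// lerDl.
  by rewrite (le_trans Xm)// lerXn2r ?nnegrE// ler_nat.
rewrite powRN exprVn.
have z0 : 0 < 4 ^+ m :> R by rewrite exprn_gt0.
have A0 : 0 < p%:R `^ a by rewrite powR_gt0.
move: (4 ^+ m) (p%:R `^ a) (Y ^+ 4) z0 A0 key => z A y z0 A0 key.
have -> : p%:R * (3 * ((y + 2) * z^-1)) =
    6 * (p%:R * A * (y + 2)) / (z * (2 * A)).
  by field; rewrite !gt_eqF.
have -> : 2^-1 * A^-1 = z / (z * (2 * A)) by field; rewrite !gt_eqF.
by rewrite ler_wpM2r// invr_ge0 !mulr_ge0// ltW.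
Qed.

(** Strict, so as to absorb the first affine layer into the depth. *)
Lemma layer_count m : (m.+1 * (2 * m).+1 < 2 * (m.+1 * m.+1))%N.
Proof. by rewrite [X in (_ < X)%N]mulnCA ltn_pmul2l//; lia. Qed.

Lemma layer_count_size n p m :
  (p * (n * 3 + 3 + (12 * (m.+1 * (2 * m).+1) + 4)) <=
   p * (n * 3 + 7 + 24 * (m.+1 * m.+1)))%N.
Proof.
rewrite leq_mul2l; apply/orP; right; have := layer_count m.
by move: (m.+1 * m.+1)%N (m.+1 * (2 * m).+1)%N => x y; lia.
Qed.

(** The net and the constant are chosen before [v], and the error bound holds for each [v]
    separately; averaging over a measure comes afterwards. *)
Lemma hartley_trunk (R : realType) (n : nat) (s : R) : (0 < n)%N -> 0 < s ->
  exists C : R, 0 < C /\ forall p : nat, (0 < p)%N -> exists tau : relu_net R n p,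
    [/\ (net_size tau)%:R <= C * p%:R * (1 + ln p%:R ^+ 2),
        (net_depth tau)%:R <= C * (1 + ln p%:R ^+ 2),
        linearly_independent (trunk tau) &
        exists taus : 'I_p -> L2 (torus_measure R n),
          let Rec := reconstruction (trunk tau) in
          let P := projection taus in
          [/\ dual_basis (trunk tau) taus,
              forall v, (Hs_norm s v < +oo)%E ->
                `|Rec (P v) - v| <= C * p%:R `^ (- s / n%:R) * fine (Hs_norm s v),
              (Lip (@l2norm R p) (fun v => `|v|%R) Rec <= 2%:E)%E &
              (Lip (fun v => `|v|%R) (@l2norm R p) P <= 2%:E)%E]].
Proof.
move=> n0 s0; have n0R : 0 < n%:R :> R by rewrite ltr0n.
have a0 : 0 < s / n%:R by rewrite divr_gt0.
have [D [D0 Dp]] := depth_choice n a0.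
have t0 : 0 < 3 `^ s by rewrite powR_gt0.
(* 3 n + 7 and 48 D^2 are for the size, where 24 (m + 1)^2 <= 48 D^2 (1 + L^2); the last summand is
   for the error. *)
exists (3 * n%:R + 7 + 48 * D ^+ 2 + 2 * (3 `^ s + 1)); split.
  by have := sqr_ge0 D; lra.
move=> p p0; have p1 : 1 <= p%:R :> R by rewrite ler1n.
set L := ln p%:R; have L0 : 0 <= L by exact: ln_ge0.
have [m [mD mK]] := Dp p p0.
have [N [kappa [kinj kN kN1 pN Np]]] := frequency_selection n0 p0.
have [Ym delta_small] := mK N.+1 Np.
set delta := (3 * _) in delta_small.
have [tau [taus taud tauE]] := hartley_net kN1 Ym.
rewrite -/delta in tauE.
have m2 : m.+1%:R ^+ 2 <= 2 * D ^+ 2 * (1 + L ^+ 2).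
  have : m.+1%:R ^+ 2 <= (D * (1 + L)) ^+ 2.
    by rewrite ler_sqr ?nnegrE ?mulr_ge0 ?addr_ge0// ltW.
  by move/le_trans; apply; have := mulr_ge0 (sqr_ge0 D) (sqr_ge0 (1 - L)); lra.
have L2 : 1 <= 1 + L ^+ 2 by rewrite lerDl sqr_ge0.
have eorth k l : inner (hartley R (kappa k)) (hartley R (kappa l)) = (k == l)%:R.
  by rewrite hartley_orthonormal (inj_eq kinj).
have pa1 : p%:R `^ (- (s / n%:R)) <= 1.
  rewrite powRN invf_le1 ?powR_gt0 ?(lt_le_trans ltr01)//.
  rewrite [leLHS](_ : _ = 1 `^ (s / n%:R)); last by rewrite powR1.
  by apply: ge0_ler_powR; rewrite ?nnegrE ?(ltW a0)// (le_trans ler01).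
(* The decay factor is at most 1, so [delta_small] also yields near-orthonormality. *)
have delta_half : p%:R * delta <= 2^-1 by lra.
exists tau; split.
- have : (net_size tau <= p * (n * 3 + 7 + 24 * (m.+1 * m.+1)))%N.
    exact: leq_trans taus (layer_count_size n p m).
  rewrite -(ler_nat R) => /le_trans; apply.
  rewrite !(natrM, natrD) -expr2 mulrAC mulrC ler_wpM2r//.
  have n3 : 0 <= 3 * n%:R + 7 + 2 * (3 `^ s + 1) :> R by have := ltW n0R; lra.
  have := ler_wpM2l n3 L2; lra.
- have : (net_depth tau <= 2 * (m.+1 * m.+1))%N.
    by rewrite taud; exact: layer_count.
  rewrite -(ler_nat R) => /le_trans; apply.
  rewrite !(natrM, natrD) -expr2.
  have n3 : 0 <= 3 * n%:R + 7 + 2 * (3 `^ s + 1) :> R by have := ltW n0R; lra.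
  have := mulr_ge0 n3 (le_trans ler01 L2).
  have := mulr_ge0 (sqr_ge0 D) (le_trans ler01 L2); lra.
- exact: near_orthonormal_independent eorth tauE delta_half.
have [tauss [h1 h2 h3 h4]] := near_orthonormal_projection eorth tauE delta_half.
exists tauss; split => // v voo.
set H := fine (Hs_norm s v).
have H0 : 0 <= H by rewrite fine_ge0// poweR_ge0.
(* The competitor for the best approximation: the outputs combined with the Hartley coefficients of
   [v]. *)
pose a : 'rV[R]_p := \row_k inner v (hartley R (kappa k)).
set e := fun k => hartley R (kappa k).
have v_le : `|v| <= 2 * H by exact: norm_le_Hs.
have tail : `|v - reconstruction e a| <= 2 * (N.+1%:R `^ (- s) * H).
  rewrite -ler_sqr ?nnegrE ?mulr_ge0 ?powR_ge0//.
  have -> : reconstruction e a =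
      \sum_(k <- codom kappa) inner v (hartley R k) *: hartley R k.
    rewrite big_map big_enum; apply: eq_bigr => j _.
    by rewrite mxE.
  apply: (le_trans (hartley_tail (N := N) s0 voo _ _)).
  - by rewrite map_inj_uniq ?enum_uniq.
  - by move=> k /kN[j <-]; exact: codom_f.
  - by rewrite -/H; have := sqr_ge0 (N.+1%:R `^ (- s) * H); lra.
(* p < (3 (N + 1))^n raised to the power s / n. *)
have N1 : N.+1%:R `^ (- s) <= 3 `^ s * p%:R `^ (- (s / n%:R)).
  rewrite !powRN ler_pdivlMr ?powR_gt0 ?(lt_le_trans ltr01)//.
  rewrite mulrC ler_pdivrMr ?powR_gt0// -powRM//.
  apply: (@le_trans _ _ (((3 * N.+1%:R) ^+ n) `^ (s / n%:R))).
    apply: ge0_ler_powR; rewrite ?nnegrE ?(ltW a0) ?exprn_ge0//.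
    by rewrite -natrM -natrX ler_nat ltnW.
  by rewrite -powR_mulrn// -powRrM mulrCA mulfV ?mulr1// gt_eqF.
rewrite mulNr (le_trans (h2 v a))//.
have := ler_distD (reconstruction e a) v (reconstruction (trunk tau) a).
have := norm_reconstruction_sub tauE a; rewrite -/e.
(* At most |v| plus the tail, each bounded by 2 H. *)
have : l2norm a <= 4 * H.
  rewrite -(norm_reconstruction_orthonormal eorth a) -/e.
  have := ler_distD v (reconstruction e a) 0; rewrite !subr0 distrC.
  have : N.+1%:R `^ (- s) * H <= H.
    rewrite -[leRHS]mul1r ler_wpM2r// powRN invf_le1 ?powR_gt0//.
    rewrite [leLHS](_ : _ = 1 `^ s); last by rewrite powR1.
    by apply: ge0_ler_powR; rewrite ?nnegrE ?(ltW s0)// ler1n.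
  lra.
have := l2norm_ge0 a; move: (l2norm a) => l l0 lH.
rewrite (distrC (reconstruction e a)).
set A := p%:R `^ (- (s / n%:R)) in N1 delta_small *.
have A0 : 0 <= A by exact: powR_ge0.
have d0 : 0 <= p%:R * delta.
  by rewrite mulr_ge0// (le_trans _ (tauE (Ordinal p0))).
(* Replacing the basis by the outputs costs 2 A H and the tail 2 * 3^s A H, whence 2 (3^s + 1) in
   the constant. *)
have h5 : p%:R * delta * l <= 2^-1 * A * (4 * H).
  by rewrite ler_pM.
have h6 : N.+1%:R `^ (- s) * H <= 3 `^ s * A * H by rewrite ler_wpM2r.
have h7 : 0 <= (3 * n%:R + 7 + 48 * D ^+ 2) * A * H.
  rewrite !mulr_ge0//; have := sqr_ge0 D; lra.
lra.
Qed.

(** * Measurability and the averaged reconstruction error *)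

(** The integral of a nonnegative function is a supremum over the simple functions below it. This
    form applies directly to the squared H^s norm of [G u]. *)
Lemma le_integral_ge0 d (T : measurableType d) (R : realType)
    (mu : {measure set T -> \bar R}) (f g : T -> \bar R) :
  (forall x, 0 <= f x)%E -> (forall x, f x <= g x)%E ->
  (\int[mu]_x f x <= \int[mu]_x g x)%E.
Proof.
move=> f0 fg; have g0 x : (0 <= g x)%E by rewrite (le_trans (f0 x)).
rewrite !ge0_integralTE//; apply: le_ereal_sup => _ [h /= hf <-].
by exists h => // x; rewrite (le_trans (hf x)).
Qed.

Lemma continuous_borel_measurable (R : realType) (V U : normedModType R) (f : V -> U) :
  continuous f -> measurable_fun setT (f : borel V -> borel U).
Proof.
move=> /continuousP cf; apply: measurability => //.
move=> _ [A oA <-]; rewrite setTI; apply: sub_sigma_algebra; exact: cf.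
Qed.

Lemma continuous_borel_measurable_fun (R : realType) (V : normedModType R) (f : V -> R) :
  continuous f -> measurable_fun setT (f : borel V -> R).
Proof.
move=> /continuousP cf; apply: (measurability _ (RGenOpens.measurableE R)).
move=> _ [_ [a [b ->] <-]]; rewrite setTI; apply: sub_sigma_algebra.
by apply: cf; exact: interval_open.
Qed.

Lemma Lip_leP (R : realType) (U V : zmodType) (nU : U -> R) (nV : V -> R)
    (f : U -> V) (c : R) : (forall x, x != 0 -> 0 < nU x) -> nU 0 = 0 -> nV 0 = 0 ->
  (Lip nU nV f <= c%:E)%E -> forall x y, nV (f x - f y) <= c * nU (x - y).
Proof.
move=> nU0 U0 V0 fc x y; have [->|xy] := eqVneq x y.
  by rewrite !subrr U0 V0 mulr0.
rewrite -ler_pdivrMr ?nU0 ?subr_eq0// -lee_fin; apply: le_trans fc.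
by apply: ereal_sup_ubound; exists (x, y).
Qed.

Lemma lipschitz_continuous_norm (R : realType) (V U : normedModType R) (f : V -> U) (L : R) :
  (forall x y, `|f x - f y| <= L * `|x - y|) -> continuous f.
Proof.
move=> fL x; apply/cvgrPdist_lt => e e0; near=> y.
apply: (le_lt_trans (fL x y)).
apply: (@le_lt_trans _ _ ((`|L| + 1) * `|x - y|)).
  by rewrite ler_wpM2r// (le_trans (ler_norm L))// lerDl.
rewrite mulrC -ltr_pdivlMr ?ltr_wpDl//; near: y.
by apply: cvgr_dist_lt; [exact: cvg_id|rewrite divr_gt0// ltr_wpDl].
Unshelve. all: end_near. Qed.

Theorem theorem3p7 (R : realType) (n : nat) (s M : R) (hn : (0 < n)%N)
    (hs : 0 < s) :
  exists C : R, 0 < C /\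
  forall (d : nat) (hd : (0 < d)%N)
    (D : set 'rV[R]_d) (hD : compact_domain D)
    (X : completeNormedModType R) (hX : separable X)
    (iota : {linear X -> L2 (domain_measure hD)})
    (iota_cont : continuous iota) (iota_inj : injective iota)
    (mu : probability (borel X) R)
    (hmu : (\int[mu]_u (`|u : X| ^+ 2)%:E < +oo)%E)
    (G : X -> L2 (torus_measure R n))
    (hG : forall u, (Hs_norm s (G u) < +oo)%E)
    (G_lip : exists L : R,
      forall u u', (Hs_norm s (G u - G u')%R <= (L * `|u - u'|)%:E)%E)
    (hM : (\int[mu]_u (Hs_norm s (G u) ^+ 2) <= M%:E)%E)
    (p : nat) (hp : (0 < p)%N),
  exists tau : relu_net R n p,
    [/\ (net_size tau)%:R <= C * p%:R * (1 + ln p%:R ^+ 2),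
        (net_depth tau)%:R <= C * (1 + ln p%:R ^+ 2),
        linearly_independent (trunk tau) &
        exists taus : 'I_p -> L2 (torus_measure R n),
          let Rec := reconstruction (trunk tau) in
          let P := projection taus in
          [/\ dual_basis (trunk tau) taus,
              (reconstruction_error
                (pushforward mu (G : borel X -> borel (L2 (torus_measure R n))))
                Rec P <= (C * p%:R `^ (- s / n%:R))%:E)%E,
              (Lip (@l2norm R p) (fun v => `|v|%R) Rec <= 2%:E)%E &
              (Lip (fun v => `|v|%R) (@l2norm R p) P <= 2%:E)%E]].
Proof.
have [C1 [C10 HC]] := hartley_trunk hn hs.
(* [M] is an arbitrary real here; the constant involves a square root of its nonnegative part. *)
pose M' := Num.max M 0.
have M'0 : 0 <= M' by rewrite le_max lexx orbT.
(* The first summand covers size and depth and keeps the constant positive; the second covers the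
   error. *)
exists (C1 + C1 * Num.sqrt M'); split; first by rewrite ltr_wpDr// mulr_ge0// ?sqrtr_ge0// ltW.
move=> d hd D hD X hX iota iota_cont iota_inj mu hmu G hG [L G_lip] hM p hp.
have [tau [taus taud tauind [tauss]]] := HC p hp.
set Rec := reconstruction (trunk tau); set P := projection tauss.
move=> /= [h1 h2 h3 h4].
have C1C : C1 <= C1 + C1 * Num.sqrt M' by rewrite lerDl mulr_ge0 ?sqrtr_ge0// ltW.
have L1 : 0 <= 1 + ln p%:R ^+ 2 :> R by rewrite addr_ge0// sqr_ge0.
exists tau; split => //.
- by rewrite (le_trans taus)// -!mulrA ler_wpM2r// mulr_ge0.
- by rewrite (le_trans taud)// ler_wpM2r.
exists tauss; split => //.
(* [norm_le_Hs] turns the H^s Lipschitz bound into an L2 one; continuity gives the Borel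
   measurability needed to integrate against the push-forward. *)
have cG : continuous G.
  apply: (@lipschitz_continuous_norm _ _ _ _ (2 * L)) => u u'.
  have oo : (Hs_norm s (G u - G u')%R < +oo)%E by rewrite (le_lt_trans (G_lip u u'))// ltry.
  have H0 : (0 <= Hs_norm s (G u - G u')%R)%E by exact: poweR_ge0.
  have HL : fine (Hs_norm s (G u - G u')) <= L * `|u - u'|.
    by rewrite -lee_fin fineK ?ge0_fin_numE.
  by rewrite -mulrA (le_trans (norm_le_Hs hs oo))// ler_wpM2l.
(* 5 = 2 * 2 + 1: the Lipschitz bounds of [Rec] and [P], plus the identity. *)
have cE : continuous (fun v => Rec (P v) - v).
  apply: (@lipschitz_continuous_norm _ _ _ _ 5) => v w.
  have l20 : l2norm (0 : 'rV[R]_p) = 0.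
    by rewrite /l2norm big1 ?sqrtr0// => k _; rewrite mxE expr0n.
  have n0 (x : L2 (torus_measure R n)) : x != 0 -> 0 < `|x| by rewrite normr_gt0.
  have r1 := Lip_leP (@l2norm_gt0 R p) l20 (normr0 _) h3 (P v) (P w).
  have r2 := Lip_leP n0 (normr0 _) l20 h4 v w.
  have -> : Rec (P v) - v - (Rec (P w) - w) = Rec (P v) - Rec (P w) - (v - w).
    by rewrite !opprD !opprK addrACA.
  by rewrite (le_trans (ler_normB _ _))//; lra.
have c0 : 0 < C1 * p%:R `^ (- s / n%:R) by rewrite mulr_gt0// powR_gt0// ltr0n.
set c := C1 * p%:R `^ (- s / n%:R) in h2 c0.
have mE : measurable_fun setT
    ((fun v => (`|Rec (P v) - v| ^+ 2)%:E) : borel (L2 (torus_measure R n)) -> \bar R).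
  apply/measurable_EFinP; apply: measurable_funX.
  apply: (@continuous_borel_measurable_fun R (L2 (torus_measure R n))
    (fun v => `|Rec (P v) - v|)).
  by move=> v; apply: (@cvg_norm _ _ _ (nbhs v)); exact: cE.
have mG : measurable_fun setT (G : borel X -> borel (L2 (torus_measure R n))).
  exact: continuous_borel_measurable.
rewrite /reconstruction_error ge0_integral_pushforward// preimage_setT /comp.
have c20 : 0 < c ^+ 2 by rewrite exprn_gt0.
have key : (\int[mu]_u (`|Rec (P (G u)) - G u| ^+ 2)%:E <= (c ^+ 2 * M')%:E)%E.
  have mF : measurable_fun setT
      ((fun u => ((c ^+ 2)^-1 * `|Rec (P (G u)) - G u| ^+ 2)%:E) : borel X -> \bar R).
    apply/measurable_EFinP; apply: measurable_funM => //; apply/measurable_EFinP.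
    exact: (measurableT_comp mE mG).
  (* The factor c^2 is pulled out of the error integral, whose integrand is known to be measurable;
     the rest is compared with the squared H^s norm by [le_integral_ge0]. *)
  have -> : (\int[mu]_u (`|Rec (P (G u)) - G u| ^+ 2)%:E =
      (c ^+ 2)%:E * \int[mu]_u ((c ^+ 2)^-1 * `|Rec (P (G u)) - G u| ^+ 2)%:E)%E.
    rewrite -ge0_integralZl_EFin// ?(ltW c20)//.
      by apply: eq_integral => u _; rewrite -EFinM mulrA mulfV ?mul1r// gt_eqF.
    by move=> u _; rewrite lee_fin mulr_ge0 ?sqr_ge0// invr_ge0 ltW.
  rewrite (EFinM (c ^+ 2) M'); apply: lee_wpmul2l; first by rewrite lee_fin ltW.
  apply: (@le_trans _ _ M%:E); last by rewrite lee_fin le_max lexx.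
  apply: le_trans hM; apply: le_integral_ge0 => u.
    by rewrite lee_fin mulr_ge0 ?sqr_ge0// invr_ge0 ltW.
  have H0 : (0 <= Hs_norm s (G u))%E by exact: poweR_ge0.
  have Hf : Hs_norm s (G u) \is a fin_num by rewrite ge0_fin_numE.
  rewrite -(fineK Hf) -EFin_expe lee_fin ler_pdivrMl// -exprMn.
  rewrite ler_sqr ?nnegrE//; first exact: h2.
  by apply: mulr_ge0; [exact: ltW|exact: fine_ge0].
apply: (@le_trans _ _ ((c ^+ 2 * M')%:E `^ 2^-1)%E).
  apply: gt0_ler_poweR => //; rewrite ?in_itv/= ?leey ?andbT.
  - by rewrite integral_ge0// => u _; rewrite lee_fin sqr_ge0.
  - by rewrite lee_fin mulr_ge0// ltW.
rewrite poweR_EFin lee_fin powR12_sqrt; last by rewrite mulr_ge0// ltW.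
rewrite sqrtrM ?(ltW c20)// sqrtr_sqr (gtr0_norm c0) mulrDl [C1 * _ * _]mulrAC.
by rewrite lerDr ltW.
Qed.
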